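(* Let $m,n\ge1$ be integers, let $(\Pi,\mathbb{C}^n)$ be the fundamental representation of $U(n)$, and let $\rho$ be a faithful positive linear functional on $\mathbb{M}_n(\mathbb{C})$. Then $K_{m,\rho}$ coincides with the closure $\overline{\Pi_{m,\infty}(B_{m,\rho})}$.
   Context: Write $G=U(n)$. $\mathbb{C}[G]\subset C(G)$ is the algebra spanned by the matrix coefficients $c^\pi_{\xi,\eta}(t)=\langle\pi(t)\xi,\eta\rangle$ of finite-dimensional unitary representations, and $\mathcal{U}(G)=\mathbb{C}[G]^*$ is its algebraic dual, with pairing $(\cdot,\cdot)$. Each finite-dimensional unitary representation $(\pi,\mathcal{K})$ extends to $\pi:\mathcal{U}(G)\to B(\mathcal{K})$ by $\langle\pi(x)\xi,\eta\rangle=(x,c^\pi_{\xi,\eta})$. An element $x\in\mathbb{M}_m(\mathbb{C})\otimes\mathcal{U}(G)$ is positive if $(\mathrm{id}_m\otimes\pi)(x)$ is positive for every finite-dimensional unitary $\pi$; $(\cdot)_+$ denotes positive elements and $x\le y$ means $y-x$ is positive. The functional $\rho\circ\Pi$ on $\mathcal{U}(G)$ is again denoted $\rho$; it has the form $x\mapsto(x,f_\rho)$ with $f_\rho\in\mathbb{C}[G]$. Define $P_\rho:\mathcal{U}(G)\to\mathcal{U}(G)$ by $(P_\rho(x),f)=(x,ff_\rho)$, $P_{m,\rho}=\mathrm{id}_m\otimes P_\rho$, and $B_{m,\rho}=\{x\in(\mathbb{M}_m(\mathbb{C})\otimes\mathcal{U}(G))_+\mid P_{m,\rho}(x)\le x\}$.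 $S_l$ acts on $\mathbb{M}_n(\mathbb{C})^{\otimes l}$ by $\sigma\cdot(x_1\otimes\cdots\otimes x_l)=x_{\sigma(1)}\otimes\cdots\otimes x_{\sigma(l)}$; $(\mathbb{M}_n(\mathbb{C})^{\otimes l})^{S_l}$ is the fixed-point algebra, $\mathbb{M}_n(\mathbb{C})^{\otimes0}=\mathbb{C}$ and $S_0$ is trivial. Then $$K_{m,\rho}=\Big\{(x_l)_{l=0}^\infty\in\prod_{l=0}^\infty(\mathbb{M}_m(\mathbb{C})\otimes(\mathbb{M}_n(\mathbb{C})^{\otimes l})^{S_l})_+\,\Big|\,(\mathrm{id}_m\otimes\mathrm{id}_n^{\otimes l}\otimes\rho)(x_{l+1})\le x_l\ \text{for all } l\ge0\Big\}.$$ A positive functional is faithful if it is strictly positive on nonzero positive elements. The closure is taken in the topology of component-wise (weak$^*$) convergence on $\prod_{l\ge0}\mathbb{M}_m(\mathbb{C})\otimes\mathbb{M}_n(\mathbb{C})^{\otimes l}$, i.e. the product topology of the usual topologies of these finite-dimensional spaces. For $l\ge1$, $\Pi^{\otimes l}:\mathcal{U}(G)\to\mathbb{M}_n(\mathbb{C})^{\otimes l}$ is the extension to $\mathcal{U}(G)$ of the $l$-fold tensor product representation, and $\Pi^{\otimes0}(x)=(x,1)$. $\Pi_{m,l}=\mathrm{id}_m\otimes\Pi^{\otimes l}$ on $\mathbb{M}_m(\mathbb{C})\otimes\mathcal{U}(G)$, and $\Pi_{m,\infty}(x)=(\Pi_{m,l}(x))_{l=0}^\infty$. *)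

(* Defs.v *)
(* The real numbers are an arbitrary R : realType, the complex ones R[i]. *)
From HB Require Import structures.
From mathcomp Require Import all_boot all_order all_algebra all_fingroup.
From mathcomp Require Import sesquilinear spectral.
From mathcomp Require Import complex mxtens.
From mathcomp Require Import all_classical all_reals all_analysis.

Set Implicit Arguments.
Unset Strict Implicit.
Unset Printing Implicit Defensive.

Import Order.TTheory GRing.Theory Num.Theory.
Import numFieldNormedType.Exports.

Local Open Scope classical_set_scope.
Local Open Scope ring_scope.
Local Open Scope sesquilinear_scope.

Set Warnings "-redundant-canonical-projection".
(* The usual topology of the complex numbers, given by the modulus. *)
HB.instance Definition _ (R : realType) := NormedModule.copy R[i] R[i]^o.

Section ScalarZmodule.
Context (K : pzRingType) (V : lmodType K).

Lemma scalar_ext (f g : {scalar V}) : (forall v, f v = g v) -> f = g.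
Proof.
case: f g => f [[f1] [f2]] [g [[g1] [g2]]] /= fg.
have E : f = g by apply/funext.
move: f1 f2 g1 g2; rewrite {}E => f1 f2 g1 g2.
by rewrite (Prop_irrelevance f1 g1) (Prop_irrelevance f2 g2).
Qed.

Definition scalar_zero : {scalar V} := \0.
Definition scalar_opp (f : {scalar V}) : {scalar V} := \- f.
Definition scalar_add (f g : {scalar V}) : {scalar V} := f \+ g.

Fact scalar_addA : associative scalar_add.
Proof. by move=> f g h; apply: scalar_ext => v /=; rewrite addrA. Qed.
Fact scalar_addC : commutative scalar_add.
Proof. by move=> f g; apply: scalar_ext => v /=; rewrite addrC. Qed.
Fact scalar_add0 : left_id scalar_zero scalar_add.
Proof. by move=> f; apply: scalar_ext => v /=; rewrite add0r. Qed.
Fact scalar_addN : left_inverse scalar_zero scalar_opp scalar_add.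
Proof. by move=> f; apply: scalar_ext => v /=; rewrite addNr. Qed.

HB.instance Definition _ := GRing.isZmodule.Build {scalar V}
  scalar_addA scalar_addC scalar_add0 scalar_addN.

Lemma scalar_subE (f g : {scalar V}) v : (f - g) v = f v - g v.
Proof. by []. Qed.

End ScalarZmodule.

Section Positivity.
Context (R : realType).
Local Notation C := R[i].

Definition inner d (u v : 'cV[C]_d) : C := (v^t* *m u) 0 0.

Definition psdmx d (A : 'M[C]_d) : Prop :=
  forall v : 'cV[C]_d, 0 <= inner (A *m v) v.

(* M_m(C) (x) A is rendered as the m x m matrices with entries in A, and
   id_m (x) f as map_mx f; for A = M_d(C), such a matrix is a block matrix. *)
Definition psdblock m d (x : 'M['M[C]_d]_m) : Prop :=
  psdmx (\mxblock_(i < m, j < m) x i j).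

Definition positive_functional d (rho : {scalar 'M[C]_d}) : Prop :=
  forall A, psdmx A -> 0 <= rho A.

Definition faithful_functional d (rho : {scalar 'M[C]_d}) : Prop :=
  forall A, psdmx A -> A != 0 -> 0 < rho A.

End Positivity.

Section UnitaryGroup.
Context (R : realType) (n : nat).
Local Notation C := R[i].

Definition unitary_set : set 'M[C]_n := [set g | g \is unitarymx].
Definition unitary_group : Type := set_type unitary_set.
HB.instance Definition _ := Choice.on unitary_group.
HB.instance Definition _ := Topological.copy unitary_group (set_type unitary_set).
Implicit Types s t : unitary_group.

Definition umx t : 'M[C]_n := val t.

Lemma umxP t : umx t \is unitarymx.
Proof. by have := valP t; rewrite inE. Qed.

Lemma umx_inj : injective umx. Proof. exact: val_inj. Qed.

Definition mkU (g : 'M[C]_n) (gU : g \is unitarymx) : unitary_group :=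
  exist _ g (mem_set gU).

Fact unitary1 : 1%:M \is @unitarymx C n n.
Proof. by apply/unitarymxP; rewrite trmx1 map_mx1 mulmx1. Qed.

Definition uone : unitary_group := mkU unitary1.
Definition umul s t : unitary_group := mkU (mul_unitarymx (umxP s) (umxP t)).
Fact uinv_subproof t : (umx t)^t* \is unitarymx.
Proof. by rewrite trmxC_unitary umxP. Qed.
Definition uinv t : unitary_group := mkU (uinv_subproof t).

Fact umulA : associative umul.
Proof. by move=> r s t; apply: umx_inj; rewrite /umx/= mulmxA. Qed.
Fact umul1 : left_id uone umul.
Proof. by move=> t; apply: umx_inj; rewrite /umx/= mul1mx. Qed.
Fact umulr1 : right_id uone umul.
Proof. by move=> t; apply: umx_inj; rewrite /umx/= mulmx1. Qed.
Fact umulrV : right_inverse uone uinv umul.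
Proof. by move=> t; apply: umx_inj; apply/unitarymxP/umxP. Qed.
Fact umulV : left_inverse uone uinv umul.
Proof. by move=> t; apply: umx_inj; apply/mulmx1C/unitarymxP/umxP. Qed.

HB.instance Definition _ :=
  isGroup.Build unitary_group umulA umul1 umulr1 umulV umulrV.

End UnitaryGroup.

Notation "''U[' R ]_ n" := (unitary_group R n)
  (at level 0, n at level 2, format "''U[' R ]_ n") : type_scope.

Section Representations.
Context (R : realType) (n : nat).
Local Notation C := R[i].
Local Notation G := 'U[R]_n.

(* Continuous unitary representations of U(n) on the Hilbert space C^d. *)
Record unitary_rep := UnitaryRep {
  rdim : nat;
  rmx :> G -> 'M[C]_rdim;
  rmx1 : rmx 1%g = 1%:M;
  rmxM : forall s t : G, rmx (s * t)%g = rmx s *m rmx t;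
  rmxU : forall t : G, rmx t \is unitarymx;
  rmxC : continuous rmx }.

Definition coef (pi : unitary_rep) (xi eta : 'cV[C]_(rdim pi)) : G -> C :=
  fun t => inner (pi t *m xi) eta.

(* C[G], the linear span of the matrix coefficients. *)
Definition poly_set : set (G -> C) := [set f |
  exists (k : nat) (a : 'I_k -> C) (g : 'I_k -> G -> C),
    (forall i, exists pi (xi eta : 'cV[C]_(rdim pi)), g i = coef xi eta) /\
    f = \sum_(i < k) a i *: g i].

Definition polyfun_pred : {pred G -> C} := fun f => `[< poly_set f >].

Lemma polyfunP f : reflect (poly_set f) (f \in polyfun_pred).
Proof. exact: asboolP. Qed.

Fact polyfun_submod : submod_closed polyfun_pred.
Proof.
split=> [|c f g /polyfunP[k [a [F [FP ->]]]] /polyfunP[l [b [H [HP ->]]]]].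
  apply/polyfunP; exists 0%N, (fun=> 0), (fun=> 0); split=> [[]//|].
  by rewrite big_ord0.
apply/polyfunP; exists (k + l)%N.
exists (fun i : 'I_(k + l) => match fintype.split i with inl u => c * a u | inr v => b v end).
exists (fun i : 'I_(k + l) => match fintype.split i with inl u => F u | inr v => H v end).
split=> [i|]; first by case: fintype.splitP => j _.
rewrite big_split_ord/= scaler_sumr; congr (_ + _); apply: eq_bigr => i _.
  by rewrite -[lshift _ _]/(unsplit (inl _)) unsplitK scalerA.
by rewrite -[rshift _ _]/(unsplit (inr _)) unsplitK.
Qed.

HB.instance Definition _ :=
  GRing.isSubmodClosed.Build C (G -> C) polyfun_pred polyfun_submod.

Record polyfun := Polyfun { pfun :> G -> C; _ : pfun \in polyfun_pred }.
HB.instance Definition _ := [isSub for pfun].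
HB.instance Definition _ := [Choice of polyfun by <:].
HB.instance Definition _ := [SubChoice_isSubLmodule of polyfun by <:].

Lemma pfun_inj (f g : polyfun) : (forall t, f t = g t) -> f = g.
Proof. by move=> fg; apply: val_inj; apply/funext. Qed.
Lemma pfunD (f g : polyfun) t : (f + g) t = f t + g t. Proof. by []. Qed.
Lemma pfunZ c (f : polyfun) t : (c *: f) t = c * f t. Proof. by []. Qed.
Lemma pfun_sum I (r : seq I) (P : pred I) (F : I -> polyfun) t :
  (\sum_(i <- r | P i) F i) t = \sum_(i <- r | P i) F i t.
Proof. exact: (big_morph (fun f : polyfun => f t)). Qed.

Fact coef_poly pi (xi eta : 'cV[C]_(rdim pi)) : coef xi eta \in polyfun_pred.
Proof.
apply/polyfunP; exists 1%N, (fun=> 1), (fun=> coef xi eta); split.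
  by move=> _; exists pi, xi, eta.
by rewrite big_ord1 scale1r.
Qed.

Definition pcoef pi (xi eta : 'cV[C]_(rdim pi)) : polyfun :=
  Polyfun (coef_poly xi eta).

(* U(G) is the algebraic dual of C[G]; the pairing (x, f) is x f. *)
Definition Udual := {scalar polyfun}.
HB.instance Definition _ := GRing.Zmodule.on Udual.

(* The extension of pi to U(G), in coordinates; see Uext_inner. *)
Definition Uext (pi : unitary_rep) (x : Udual) : 'M[C]_(rdim pi) :=
  \matrix_(p, q) x (@pcoef pi (delta_mx q 0) (delta_mx p 0)).

Lemma innerE d (u v : 'cV[C]_d) : inner u v = \sum_k (v k 0)^* * u k 0.
Proof. by rewrite /inner mxE; apply: eq_bigr => k _; rewrite !mxE. Qed.

Lemma inner_mul d (A : 'M[C]_d) (u v : 'cV[C]_d) :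
  inner (A *m u) v = \sum_p \sum_q ((v p 0)^* * u q 0) * A p q.
Proof.
rewrite innerE; apply: eq_bigr => p _; rewrite mxE mulr_sumr.
by apply: eq_bigr => q _; rewrite -mulrA [A p q * _]mulrC.
Qed.

Lemma inner_delta d (A : 'M[C]_d) p q :
  inner (A *m delta_mx q 0) (delta_mx p 0) = A p q.
Proof.
rewrite -colE innerE (bigD1 p)//= big1 ?addr0; last first.
  by move=> k kp; rewrite !mxE (negbTE kp)/= conjC0 mul0r.
by rewrite !mxE !eqxx conjC1 mul1r.
Qed.

Lemma coef_delta pi (p q : 'I_(rdim pi)) t :
  @coef pi (delta_mx q 0) (delta_mx p 0) t = pi t p q.
Proof. exact: inner_delta. Qed.

Lemma pcoefE pi (xi eta : 'cV[C]_(rdim pi)) :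
  pcoef xi eta = \sum_p \sum_q ((eta p 0)^* * xi q 0) *:
     @pcoef pi (delta_mx q 0) (delta_mx p 0).
Proof.
apply: pfun_inj => t; rewrite pfun_sum /= /coef inner_mul.
apply: eq_bigr => p _; rewrite pfun_sum; apply: eq_bigr => q _.
by rewrite pfunZ /= /coef inner_delta.
Qed.

Lemma Uext_inner (pi : unitary_rep) (x : Udual) (xi eta : 'cV[C]_(rdim pi)) :
  inner (Uext pi x *m xi) eta = x (pcoef xi eta).
Proof.
rewrite pcoefE inner_mul linear_sum; apply: eq_bigr => p _.
rewrite linear_sum; apply: eq_bigr => q _.
by rewrite linearZ/= !mxE.
Qed.

Definition Upos m (x : 'M[Udual]_m) : Prop :=
  forall pi : unitary_rep, psdblock (map_mx (Uext pi) x).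

Lemma continuous_mx (T : topologicalType) p q (f : T -> 'M[C]_(p, q)) :
  (forall i j, continuous (fun x => f x i j)) -> continuous f.
Proof.
move=> fc x A [P fP PA].
suff : \forall y \near x, forall i j, P i j (f y i j).
  by apply: filterS => y yP; exact: PA.
have F := nbhs_filter x.
apply: (@filter_forall _ _ (fun i y => forall j, P i j (f y i j)) _ F) => i.
apply: (@filter_forall _ _ (fun j y => P i j (f y i j)) _ F) => j.
exact: (fc i j x (P i j) (fP i j)).
Qed.

Lemma continuous_entry (T : topologicalType) p q (f : T -> 'M[C]_(p, q)) i j :
  continuous f -> continuous (fun x => f x i j).
Proof.
move=> fc x A nA; suff nM : nbhs (f x) [set M | A (M i j)] by exact: fc nM.
exists (fun i' j' => if (i' == i) && (j' == j) then A else setT).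
  by move=> i' j'; case: ifP => [/andP[/eqP-> /eqP->]//|_]; exact: filterT.
by move=> M /(_ i j); rewrite !eqxx.
Qed.

Lemma continuousMC (T : topologicalType) (f g : T -> C) :
  continuous f -> continuous g -> continuous (fun x => f x * g x).
Proof. by move=> fc gc x; apply: cvgM; [exact: fc|exact: gc]. Qed.

Lemma continuous_prodC (T : topologicalType) (I : Type) (r : seq I)
    (F : I -> T -> C) :
  (forall i, continuous (F i)) -> continuous (fun x => \prod_(i <- r) F i x).
Proof.
move=> Fc; elim: r => [|i r IHr].
  have -> : (fun x => \prod_(i <- [::]) F i x) = (fun=> 1).
    by apply/funext => x; rewrite big_nil.
  exact: cst_continuous.
have -> : (fun x => \prod_(j <- i :: r) F j x) =
    (fun x => F i x * \prod_(j <- r) F j x).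
  by apply/funext => x; rewrite big_cons.
exact: continuousMC.
Qed.

Section TensorProduct.
Variables pi pi' : unitary_rep.
Let d := (rdim pi * rdim pi')%N.
Let T : G -> 'M[C]_d := fun t => pi t *t pi' t.

Fact tens1 p q : (1%:M : 'M[C]_p) *t (1%:M : 'M[C]_q) = 1%:M.
Proof.
apply/matrixP => i j; case: (mxtens_indexP i) => i1 i2.
case: (mxtens_indexP j) => j1 j2; rewrite tensmxE !mxE -natrM mulnb.
by rewrite (can_eq (@mxtens_indexK _ _)) xpair_eqE.
Qed.

Fact tens_rep1 : T 1%g = 1%:M.
Proof. by rewrite /T !rmx1 tens1. Qed.
Fact tens_repM s t : T (s * t)%g = T s *m T t.
Proof. by rewrite /T !rmxM tensmx_mul. Qed.
Fact tens_repU t : T t \is unitarymx.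
Proof.
apply/unitarymxP; rewrite trmx_tens map_mxT tensmx_mul.
by rewrite !(unitarymxP (rmxU _ _)) tens1.
Qed.
Fact tens_repC : continuous T.
Proof.
have rC (r : unitary_rep) a b : continuous (fun t => r t a b).
  by apply: continuous_entry; exact: rmxC.
apply: continuous_mx => i j; rewrite /T.
under eq_fun do rewrite mxE.
by apply: continuousMC; exact: rC.
Qed.

Definition tensor_rep := UnitaryRep tens_rep1 tens_repM tens_repU tens_repC.

Lemma coef_tensor (xi eta : 'cV[C]_(rdim pi)) (xi' eta' : 'cV[C]_(rdim pi')) :
  exists z w : 'cV[C]_(rdim tensor_rep),
    coef z w = fun t => coef xi eta t * coef xi' eta' t.
Proof.
exists (xi *t xi'), (eta *t eta'); apply/funext => t; rewrite /coef.
have adj : (eta *t eta' : 'cV[C]_d)^t* = (eta^t*) *t (eta'^t*).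
  by apply/matrixP => a b; rewrite !mxE rmorphM.
rewrite [LHS]/inner adj /= /T.
have -> : (pi t *t pi' t) *m (xi *t xi') = (pi t *m xi) *t (pi' t *m xi').
  exact: tensmx_mul.
have -> : ((eta ^t*) *t (eta' ^t*)) *m ((pi t *m xi) *t (pi' t *m xi')) =
    ((eta^t* *m (pi t *m xi)) *t (eta'^t* *m (pi' t *m xi'))).
  exact: tensmx_mul.
by rewrite mxE !ord1.
Qed.

End TensorProduct.

Fact polyfunM (f g : polyfun) : (fun t => f t * g t) \in polyfun_pred.
Proof.
case: f g => f /= /polyfunP[k [a [F [FP ->]]]].
case=> g /= /polyfunP[l [b [H [HP ->]]]].
have -> : (fun t => (\sum_(i < k) a i *: F i) t * (\sum_(i < l) b i *: H i) t) =
   \sum_(i < k) \sum_(j < l) (a i * b j) *: (fun t => F i t * H j t).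
  apply/funext => t; rewrite !fct_sumE mulr_suml; apply: eq_bigr => i _.
  rewrite fct_sumE mulr_sumr; apply: eq_bigr => j _.
  by rewrite /= /GRing.scale /= mulrACA.
apply: rpred_sum => i _; apply: rpred_sum => j _; apply: rpredZ.
have [pi [xi [eta ->]]] := FP i; have [pi' [xi' [eta' ->]]] := HP j.
by have [z [w <-]] := coef_tensor xi eta xi' eta'; exact: coef_poly.
Qed.

Definition pmul (f g : polyfun) : polyfun := Polyfun (polyfunM f g).

Definition pmulr (g f : polyfun) : polyfun := pmul f g.

Fact pmulr_linear g : linear (pmulr g).
Proof.
move=> c f h; apply: pfun_inj => t.
have := mulrDl (c * f t) (h t) (g t); rewrite -mulrA; exact.
Qed.
HB.instance Definition _ g :=
  GRing.isLinear.Build C polyfun polyfun _ (pmulr g) (pmulr_linear g).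

Definition Umulr (g : polyfun) (x : Udual) : Udual := x \o pmulr g.

Lemma UmulrE g x f : Umulr g x f = x (pmul f g).
Proof. by []. Qed.

Fact umxC : continuous (@umx R n).
Proof. exact: initial_continuous. Qed.

Definition fund_rep : unitary_rep :=
  @UnitaryRep n (@umx R n) erefl (fun _ _ => erefl) (@umxP R n) umxC.

Section Frho.
Variable rho : {scalar 'M[C]_n}.

Let f := fun t : G => rho (fund_rep t).

Fact frho_poly : f \in polyfun_pred.
Proof.
have -> : f = \sum_p \sum_q rho (delta_mx p q) *:
   @coef fund_rep (delta_mx q 0) (delta_mx p 0).
  apply/funext => t; rewrite /f {1}[fund_rep t]matrix_sum_delta linear_sum.
  rewrite fct_sumE; apply: eq_bigr => p _; rewrite linear_sum fct_sumE.
  apply: eq_bigr => q _; rewrite linearZ /= mulrC.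
  by rewrite -[RHS]/(rho _ * coef _ _ t) coef_delta.
apply: rpred_sum => p _; apply: rpred_sum => q _; apply: rpredZ.
exact: coef_poly.
Qed.

(* f_rho(t) = rho(Pi(t)); frhoE shows that x |-> (x, f_rho) is rho o Pi. *)
Definition frho : polyfun := Polyfun frho_poly.

Lemma frhoE (x : Udual) : rho (Uext fund_rep x) = x frho.
Proof.
have -> : frho = \sum_p \sum_q rho (delta_mx p q) *:
   @pcoef fund_rep (delta_mx q 0) (delta_mx p 0).
  apply: pfun_inj => t; rewrite pfun_sum /= /f {1}[fund_rep t]matrix_sum_delta.
  rewrite linear_sum; apply: eq_bigr => p _; rewrite linear_sum pfun_sum.
  apply: eq_bigr => q _; rewrite linearZ pfunZ.
  by rewrite -[(pcoef _ _) t]/(coef _ _ t) coef_delta; exact: mulrC.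
rewrite {1}[Uext _ _]matrix_sum_delta !linear_sum; apply: eq_bigr => p _.
rewrite !linear_sum; apply: eq_bigr => q _.
by rewrite !linearZ/= mxE mulrC.
Qed.

Definition Prho : Udual -> Udual := Umulr frho.

End Frho.

Definition Bset m (rho : {scalar 'M[C]_n}) : set 'M[Udual]_m :=
  [set x | Upos x /\ Upos (x - map_mx (Prho rho) x)].

End Representations.

Section TensorPowers.
Context (R : realType) (n : nat).
Local Notation C := R[i].
Local Notation G := 'U[R]_n.

(* M_n(C)^{(x) l} is the algebra of matrices indexed by the multi-indices
   {1..n}^l, through the enumeration of this finite type. *)
Definition tdim l : nat := #|{ffun 'I_l -> 'I_n}|.

Definition mindex l (p : 'I_(tdim l)) : {ffun 'I_l -> 'I_n} := enum_val p.
Definition mrank l (s : {ffun 'I_l -> 'I_n}) : 'I_(tdim l) := enum_rank s.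

Lemma mrankK l : cancel (@mrank l) (@mindex l). Proof. exact: enum_rankK. Qed.
Lemma mindexK l : cancel (@mindex l) (@mrank l). Proof. exact: enum_valK. Qed.

(* The elementary tensor x_1 (x) ... (x) x_l in these coordinates. *)
Definition etens l (x : 'I_l -> 'M[C]_n) : 'M[C]_(tdim l) :=
  \matrix_(p, q) \prod_(k < l) x k (mindex p k) (mindex q k).

Lemma etensM l (x y : 'I_l -> 'M[C]_n) :
  etens (fun k => x k *m y k) = etens x *m etens y.
Proof.
apply/matrixP => p q; rewrite !mxE.
under eq_bigr do rewrite mxE.
rewrite bigA_distr_bigA/= (reindex (@mindex l)); last first.
  by exists (@mrank l) => ? _; rewrite (mindexK, mrankK).
by apply: eq_bigr => r _; rewrite !mxE -big_split.
Qed.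

Lemma etens1 l : etens (fun _ : 'I_l => 1%:M) = 1%:M.
Proof.
apply/matrixP => p q; rewrite !mxE; have [->|pq] := eqVneq p q.
  by rewrite big1// => k _; rewrite mxE eqxx.
have [k kP] : exists k, mindex p k != mindex q k.
  apply/existsP; rewrite -negb_forall; apply: contra pq => /forallP pq.
  by rewrite -(can_eq (@mindexK l)); apply/eqP/ffunP => k; apply/eqP.
by rewrite (bigD1 k)//= mxE (negbTE kP) mul0r.
Qed.

Lemma etens_adj l (x : 'I_l -> 'M[C]_n) :
  (etens x)^t* = etens (fun k => (x k)^t*).
Proof.
apply/matrixP => p q; rewrite !mxE rmorph_prod.
by apply: eq_bigr => k _; rewrite !mxE.
Qed.

Section TensRep.
Variable l : nat.
Let T (t : G) := etens (fun _ : 'I_l => fund_rep R n t).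

Fact tpow1 : T 1%g = 1%:M.
Proof. by rewrite /T rmx1 etens1. Qed.
Fact tpowM s t : T (s * t)%g = T s *m T t.
Proof. by rewrite /T rmxM etensM. Qed.
Fact tpowU t : T t \is unitarymx.
Proof.
apply/unitarymxP; rewrite /T etens_adj -etensM -etens1; congr etens.
by apply/funext => k; apply/unitarymxP; exact: umxP.
Qed.
Fact tpowC : continuous T.
Proof.
apply: continuous_mx => p q; rewrite /T.
under eq_fun do rewrite mxE.
by apply: continuous_prodC => k; apply: continuous_entry; exact: umxC.
Qed.

Definition tpow_rep : unitary_rep R n := UnitaryRep tpow1 tpowM tpowU tpowC.

End TensRep.

(* The action of sigma : S_l on M_n(C)^{(x) l}; see taction_etens. *)
Definition taction l (sigma : 'S_l) (X : 'M[C]_(tdim l)) : 'M[C]_(tdim l) :=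
  let act p := mrank [ffun k => mindex p ((sigma^-1)%g k)] in
  \matrix_(p, q) X (act p) (act q).

Lemma taction_etens l (sigma : 'S_l) (x : 'I_l -> 'M[C]_n) :
  taction sigma (etens x) = etens (fun k => x (sigma k)).
Proof.
apply/matrixP => p q; rewrite !mxE (reindex_perm sigma)/=.
by apply: eq_bigr => k _; rewrite !mrankK !ffunE permK.
Qed.

(* The multi-index (s_1, ..., s_l, a). *)
Definition mrcons l (s : {ffun 'I_l -> 'I_n}) (a : 'I_n) :
    {ffun 'I_l.+1 -> 'I_n} :=
  [ffun k => if unlift ord_max k is Some k' then s k' else a].

(* id_n^{(x) l} (x) rho; see slice_etens. *)
Definition slice l (rho : {scalar 'M[C]_n}) (X : 'M[C]_(tdim l.+1)) :
    'M[C]_(tdim l) :=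
  \matrix_(p, q) rho (\matrix_(a, b)
    X (mrank (mrcons (mindex p) a)) (mrank (mrcons (mindex q) b))).

Lemma slice_etens l (rho : {scalar 'M[C]_n}) (x : 'I_l.+1 -> 'M[C]_n) :
  slice rho (etens x) =
  rho (x ord_max) *: etens (fun k => x (widen_ord (leqnSn l) k)).
Proof.
apply/matrixP => p q; rewrite !mxE mulrC.
transitivity (rho (\prod_(k < l) x (widen_ord (leqnSn l) k)
    (mindex p k) (mindex q k) *: x ord_max)); last by rewrite linearZ.
congr (rho _); apply/matrixP => a b; rewrite !mxE big_ord_recr/=; congr (_ * _).
  apply: eq_bigr => k _; rewrite !mrankK !ffunE.
  have -> : widen_ord (leqnSn l) k = lift ord_max k.
    by apply: val_inj; rewrite /= /bump leqNgt ltn_ord.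
  by rewrite liftK.
by rewrite !mrankK !ffunE unlift_none.
Qed.

(* The ambient product of the spaces M_m(C) (x) M_n(C)^{(x) l}, l >= 0, with
   the product topology. *)
Definition tseq m : Type := prod_topology (fun l => 'M['M[C]_(tdim l)]_m).
HB.instance Definition _ m := Topological.on (tseq m).

Definition Kset m (rho : {scalar 'M[C]_n}) : set (tseq m) :=
  [set x : tseq m | forall l,
    [/\ forall i j (sigma : 'S_l), taction sigma (x l i j) = x l i j,
        psdblock (x l)
      & psdblock (x l - map_mx (slice rho) (x l.+1))]].

Definition Pi_inf m (x : 'M[Udual R n]_m) : tseq m :=
  fun l => map_mx (Uext (tpow_rep l)) x.

End TensorPowers.

Arguments Bset {R n} m rho.
Arguments Kset {R n} m rho.
Arguments Pi_inf {R n m} x.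

(* Main.v *)
Require Import Defs.
From HB Require Import structures.
From mathcomp Require Import all_boot all_order all_algebra all_fingroup.
From mathcomp Require Import sesquilinear spectral.
From mathcomp Require Import complex mxtens.
From mathcomp Require Import all_classical all_reals all_analysis.
From mathcomp Require Import ring zify.

(** The inclusion of the closure in [K] holds because [id (x) rho], which maps the
    tensor power [l+1] to the tensor power [l], is the operator [P_rho] seen
    through the representations [Pi^(l)] ([Uext_Prho_tpow]), and because [K] is
    cut out by closed conditions on finitely many coordinates ([closed_Kset]).

    For the converse, a sequence [(x_l)] of [K] is the limit of its truncations
    [(x_0, ..., x_N, 0, 0, ...)], which are again in [K]. So it suffices that a
    finitely supported element of [K] is in the image of [B] itself
    ([finite_Kset_image]). Its defects [w_l = x_l - (id (x) rho)(x_(l+1))] are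
    positive. Suppose that [om] is positive over [U(G)] with [Pi^(l)(om) = w_l] for
    all [l], and that the potential [y = om + P_rho om + P_rho^2 om + ...] makes
    sense. As [P_rho] preserves positivity ([Upos_Prho]), [y] is positive; as
    [y - P_rho y = om], it is in [B]; and since [y] and [x] have the same defects
    and vanish on all high tensor powers, [Pi^(l)(y) = x_l] for all [l].

    To find [om], one lifts each [w_l] to a positive element. The powers
    [u^(l)] of unitary matrices span the fixed-point algebra ([schur_weyl]), so that
    [w_l] is the image of a matrix over the group algebra; a square root of [w_l]
    is a polynomial in [w_l], hence also such an image, and [w_l] is the image of a
    matrix of the form [c^adj c], which is positive in all representations
    ([lift_psdblock]). This lift has uncontrolled images in the other tensor
    powers. They are removed by a grading: a central element [z 1] of [U(n)], with
    [z] of modulus 1 and not a root of unity, acts on [Pi^(l)] as [z^l]. The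
    translation of functions by it is diagonalizable on [C[G]], as unitary matrices
    are, and the projection on the eigenvalue [z^l] preserves positivity
    ([Upos_Udeg]), keeps the image in [Pi^(l)] and kills the images in all other
    tensor powers ([Uext_Udeg_tpow]).

    The same grading makes the potential converge. Multiplication by [f_rho]
    multiplies eigenvalues by [z], so that for an eigenfunction [f] at most one of
    the products [f f_rho^k] has the eigenvalue [z^l]; hence on each [f] only
    finitely many terms [P_rho^k om] do not vanish ([locally_finite_Udeg]). *)

Set Implicit Arguments.
Unset Strict Implicit.
Unset Printing Implicit Defensive.

Import Order.TTheory GRing.Theory Num.Theory.
Import numFieldNormedType.Exports.

Local Open Scope classical_set_scope.
Local Open Scope ring_scope.
Local Open Scope sesquilinear_scope.

(** * Linear algebra over the complex numbers *)

Section LinearPred.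
Variables (K : fieldType) (V : lmodType K).

(** Subspaces are kept as propositions: the ones used below are spans of infinite
    families, for which no boolean membership test is at hand. *)
Definition linear_pred (P : V -> Prop) : Prop :=
  P 0 /\ forall c u v, P u -> P v -> P (c *: u + v).

Lemma linear_predZ (P : V -> Prop) c v :
  linear_pred P -> P v -> P (c *: v).
Proof. by move=> [P0 PD] Pv; rewrite -[_ *: _]addr0; exact: PD. Qed.

Lemma linear_pred_sum (P : V -> Prop) (I : Type) [r : seq I]
    (Q : pred I) (F : I -> V) :
  linear_pred P -> (forall i, Q i -> P (F i)) -> P (\sum_(i <- r | Q i) F i).
Proof.
by move=> [P0 PD] PF; elim/big_ind: _ => // u v Pu Pv; rewrite -[u]scale1r; exact: PD.
Qed.

(** The coefficients of a vector-valued polynomial are linear combinations of its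
    values at distinct points, because the Vandermonde matrix is invertible. *)
Lemma linear_pred_coef (P : V -> Prop) (z : nat -> K) N
    (v : 'I_N -> V) :
    linear_pred P -> injective z -> (forall k, P (\sum_(i < N) z k ^+ i *: v i)) ->
  forall i, P (v i).
Proof.
move=> Psub zI Pz i.
pose W := Vandermonde N (\row_(k < N) z k).
have Wu : W \in unitmx.
  rewrite unitmxE det_Vandermonde unitfE; apply/prodf_neq0 => j _.
  apply/prodf_neq0 => k jk; rewrite !mxE subr_eq0; apply: contraTneq jk => /zI.
  by move=> ->; rewrite ltnn.
have -> : v i = \sum_(k < N) invmx W k i *: \sum_(j < N) z k ^+ j *: v j.
  under eq_bigr do rewrite scaler_sumr.
  rewrite exchange_big /= (bigD1 i)//= [X in _ + X]big1 => [|j ji].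
    under eq_bigr do rewrite scalerA mulrC.
    rewrite -scaler_suml addr0 -[LHS]scale1r; congr (_ *: _).
    transitivity ((W *m invmx W) i i); first by rewrite mulmxV// mxE eqxx.
    by rewrite mxE; apply: eq_bigr => k _; rewrite !mxE.
  under eq_bigr do rewrite scalerA mulrC.
  rewrite -scaler_suml (_ : \sum_k _ = 0) ?scale0r//.
  transitivity ((W *m invmx W) j i); last by rewrite mulmxV// mxE (negbTE ji).
  by rewrite mxE; apply: eq_bigr => k _; rewrite !mxE.
by apply: (linear_pred_sum Psub) => k _; exact: linear_predZ.
Qed.

End LinearPred.

Lemma interpolation (C : fieldType) (s : seq C) (f : C -> C) :
  exists q : {poly C}, {in s, forall x, q.[x] = f x}.
Proof.
elim: s => [|x s [q qP]]; first by exists 0.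
have [xs|xs] := boolP (x \in s).
  by exists q => y; rewrite inE => /predU1P[->|]; exact: qP.
pose w := \prod_(y <- s) ('X - y%:P).
have wx : w.[x] != 0 by rewrite -/(root w x) root_prod_XsubC.
(* The correction is a multiple of [w], which vanishes on [s]. *)
exists (q + ((f x - q.[x]) / w.[x]) *: w) => y; rewrite inE hornerD hornerZ.
move=> /predU1P[->|ys]; first by rewrite divfK// addrC subrK.
have /rootP -> : root w y by rewrite root_prod_XsubC.
by rewrite mulr0 addr0 qP.
Qed.

Section Spectral.
Variable C : numClosedFieldType.

Lemma adjM p q r (A : 'M[C]_(p, q)) (B : 'M[C]_(q, r)) :
  (A *m B)^t* = B^t* *m A^t*.
Proof. by rewrite trmx_mul map_mxM. Qed.

(** Polarization: with [v = e_i + c e_j], the cross terms of [v v^*] for [c = 1] and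
    [c = 'i] span the matrix units of position [(i, j)] and [(j, i)]. *)
Lemma linear_pred_rank1 n (P : 'M[C]_n -> Prop) : linear_pred P ->
  (forall v : 'cV[C]_n, P (v *m v^t*)) -> forall X, P X.
Proof.
move=> Plin Pv X; have [P0 PD] := Plin.
have PD' Y Z : P Y -> P Z -> P (Y + Z).
  by move=> PY PZ; rewrite -[Y]scale1r; exact: PD.
have PB Y Z : P (Y + Z) -> P Z -> P Y.
  by move=> PYZ PZ; have := PD (-1) _ _ PZ PYZ; rewrite scaleN1r addrC addrK.
rewrite [X]matrix_sum_delta; apply: (linear_pred_sum Plin) => i _.
apply: (linear_pred_sum Plin) => j _; apply: (linear_predZ _ Plin).
pose d k : 'cV[C]_n := delta_mx k 0.
have dd p q : d p *m (d q)^t* = delta_mx p q.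
  by rewrite trmx_delta map_delta_mx mul_delta_mx.
have pol c : P (c^* *: delta_mx i j + c *: delta_mx j i).
  apply: (PB _ (delta_mx i i + (c * c^*) *: delta_mx j j)); last first.
    apply: PD'; first by rewrite -dd.
    by apply: linear_predZ => //; rewrite -dd.
  have := Pv (d i + c *: d j).
  rewrite linearD linearZ /= map_mxD map_mxZ mulmxDl !mulmxDr.
  rewrite -!scalemxAl -!scalemxAr !dd scalerA.
  suff -> (E a b t : 'M[C]_n) : E + a + (b + t) = a + b + (E + t) by [].
  by rewrite [E + a]addrC addrACA.
have E : 'i *: ('i^* *: delta_mx i j + 'i *: delta_mx j i) +
    (1^* *: delta_mx i j + 1 *: delta_mx j i) = 2 *: delta_mx i j :> 'M[C]_n.
  rewrite scalerDr !scalerA conjC1 !scale1r conjCi mulrN -expr2 sqrCi.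
  by rewrite opprK scale1r scaleN1r addrACA addNr addr0 -mulr2n scaler_nat.
rewrite -[delta_mx i j]scale1r -(@mulVf _ (2 : C)) ?pnatr_eq0// -scalerA -E.
by apply: (linear_predZ _ Plin); exact: PD.
Qed.

Lemma normal_diag d (A : 'M[C]_d) : A \is normalmx ->
  exists (U : 'M[C]_d) (a : 'rV[C]_d),
    [/\ U *m U^t* = 1%:M, U^t* *m U = 1%:M & A = U^t* *m diag_mx a *m U].
Proof.
move=> /orthomx_spectralP; have Uu := spectral_unitarymx A.
set U := spectralmx A in Uu *; set a := spectral_diag A => AE.
have UU : U *m U^t* = 1%:M by apply/unitarymxP.
exists U, a; split=> //; first exact: mulmx1C.
by rewrite {1}AE (invmx_unitary Uu).
Qed.

Lemma normal_eigen d (A : 'M[C]_d) : A \is normalmx ->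
  exists (E : 'I_d -> 'M[C]_d) (a : 'I_d -> C),
    1%:M = \sum_i E i /\ forall i, A *m E i = a i *: E i.
Proof.
move=> /normal_diag[U [a [UU U'U ->]]].
exists (fun i => U^t* *m delta_mx i i *m U), (fun i => a 0 i); split=> [|i].
  by rewrite -mulmx_suml -mulmx_sumr -mx1_sum_delta mulmx1.
rewrite !mulmxA -(mulmxA _ U) UU mulmx1.
have -> : U^t* *m diag_mx a *m delta_mx i i = a 0 i *: (U^t* *m delta_mx i i).
  rewrite -mulmxA scalemxAr; congr (_ *m _); apply/matrixP => j k.
  by rewrite mul_diag_mx !mxE; case: eqVneq => [->|]; rewrite ?mulr0.
by rewrite -scalemxAl.
Qed.

(** [S] inverts [A - al] off its kernel and vanishes on it. The equations with [S] say
    that the complement of the eigenspace is the range of [A - al], a form that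
    still makes sense for the translation of functions on the group. *)
Lemma spectral_projection d (A : 'M[C]_d) (al : C) : A \is normalmx ->
  exists Q S : 'M[C]_d,
    [/\ Q^t* = Q, Q *m Q = Q, A *m Q = al *: Q /\ Q *m A = al *: Q,
        Q + (A - al%:M) *m S = 1%:M & Q + S *m (A - al%:M) = 1%:M].
Proof.
move=> /normal_diag[U [a [UU U'U ->]]].
pose D (b : 'rV[C]_d) := U^t* *m diag_mx b *m U.
have DM b c : D b *m D c = D (\row_i (b 0 i * c 0 i)).
  rewrite /D !mulmxA -(mulmxA _ U) UU mulmx1 -(mulmxA _ (diag_mx b)).
  by rewrite mulmx_diag.
have DZ x b : x *: D b = D (x *: b).
  by rewrite /D linearZ /= -scalemxAr -scalemxAl.
have DD b c : D b + D c = D (b + c).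
  by rewrite /D linearD /= mulmxDr mulmxDl.
have D1 x : D (const_mx x) = x%:M.
  by rewrite /D diag_const_mx mul_mx_scalar -scalemxAl U'U scalemx1.
have DN b : - D b = D (- b) by rewrite -scaleN1r DZ scaleN1r.
have Dadj (b : 'rV[C]_d) : (forall i, (b 0 i)^* = b 0 i) -> (D b)^t* = D b.
  move=> bR; rewrite /D !adjM trmxCK mulmxA; congr (_ *m _ *m _).
  apply/matrixP => i j; rewrite !mxE [j == i]eq_sym; case: (eqVneq i j) => [->|_].
    by rewrite !mulr1n bR.
  by rewrite !mulr0n conjC0.
rewrite -[U^t* *m _ *m U]/(D a) -(D1 al) -(D1 1).
clearbody D; clear UU U'U.
pose q : 'rV[C]_d := \row_i (a 0 i == al)%:R.
pose s : 'rV[C]_d := \row_i (if a 0 i == al then 0 else (a 0 i - al)^-1).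
exists (D q), (D s); rewrite DN DD !DM DZ !DD.
split.
- by apply: Dadj => i; rewrite mxE conjC_nat.
- by congr D; apply/rowP => i; rewrite !mxE -natrM mulnb andbb.
- split; congr D; apply/rowP => i; rewrite !mxE; case: eqVneq => [->|_].
  + by [].
  + by rewrite !mulr0.
  + by rewrite mulrC.
  + by rewrite mulr0 mul0r.
- congr D; apply/rowP => i; rewrite !mxE; case: eqVneq => [->|].
    by rewrite mulr0 addr0.
  by rewrite -subr_eq0 => ?; rewrite add0r mulfV.
- congr D; apply/rowP => i; rewrite !mxE; case: eqVneq => [->|].
    by rewrite mul0r addr0.
  by rewrite -subr_eq0 => ?; rewrite add0r mulVf.
Qed.

(** The square root of [A] is a polynomial in [A], which interpolates the scalar
    square root on the spectrum; hence it stays in every unital algebra that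
    contains [A]. *)
Lemma psd_sqrt N (A : 'M[C]_N) (P : 'M[C]_N -> Prop) :
    linear_pred P -> P 1%:M -> (forall X Y, P X -> P Y -> P (X *m Y)) ->
  P A -> A^t* = A -> (forall v : 'cV[C]_N, 0 <= (v^t* *m (A *m v)) 0 0) ->
  exists S, [/\ P S, S^t* = S & A = S *m S].
Proof.
case: N A P => [|N] A P Psub P1 PM PA Aadj Apos.
  by exists A; split=> //; rewrite [LHS]flatmx0 [RHS]flatmx0.
have [U [a [UU U'U AE]]] : exists (U : 'M[C]_N.+1) (a : 'rV[C]_N.+1),
    [/\ U *m U^t* = 1%:M, U^t* *m U = 1%:M & A = U^t* *m diag_mx a *m U].
  by apply: normal_diag; apply/normalmxP; rewrite Aadj.
have a0 i : 0 <= a 0 i.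
  pose v : 'cV[C]_N.+1 := U^t* *m delta_mx i 0.
  suff <- : (v^t* *m (A *m v)) 0 0 = a 0 i by exact: Apos.
  rewrite /v adjM trmxCK {1}AE -!mulmxA (mulmxA U) UU mul1mx (mulmxA U) UU mul1mx.
  by rewrite trmx_delta map_delta_mx -rowE -colE !mxE eqxx mulr1n.
have [q qa] := interpolation [seq a 0 i | i : 'I_N.+1] sqrtC.
have qE p : horner_mx A p = U^t* *m diag_mx (map_mx (horner p) a) *m U.
  elim/poly_ind: p => [|p c IH].
    rewrite raddf0 (_ : map_mx (horner 0) a = 0) ?linear0 ?mulmx0 ?mul0mx//.
    by apply/rowP => i; rewrite !mxE horner0.
  rewrite rmorphD rmorphM /= horner_mx_X horner_mx_C IH {1}AE -mulmxE !mulmxA.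
  rewrite -(mulmxA _ U) UU mulmx1 -(mulmxA _ (diag_mx _) (diag_mx _)) mulmx_diag.
  have -> : (c%:M : 'M[C]_N.+1) = U^t* *m diag_mx (const_mx c) *m U.
    by rewrite diag_const_mx mul_mx_scalar -scalemxAl U'U scalemx1.
  rewrite -mulmxDl -mulmxDr -linearD /=; congr (_ *m diag_mx _ *m _).
  by apply/rowP => i; rewrite !mxE !hornerE.
have qai i : q.[a 0 i] = sqrtC (a 0 i).
  by apply: qa; apply/mapP; exists i; rewrite ?mem_enum.
exists (horner_mx A q); split.
- elim/poly_ind: (q) => [|p c IH]; first by rewrite raddf0; case: Psub.
  rewrite rmorphD rmorphM /= horner_mx_X horner_mx_C -mulmxE addrC.
  rewrite -scalemx1; case: Psub => _; apply=> //; exact: PM.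
- rewrite qE !adjM trmxCK mulmxA; congr (_ *m _ *m _).
  apply/matrixP => i j; rewrite !mxE [j == i]eq_sym; case: (eqVneq i j) => [->|_].
    by rewrite !mulr1n qai; apply/CrealP/ger0_real; rewrite sqrtC_ge0.
  by rewrite !mulr0n conjC0.
- rewrite qE !mulmxA -(mulmxA _ U) UU mulmx1 -(mulmxA _ (diag_mx _) (diag_mx _)) mulmx_diag.
  rewrite AE; congr (_ *m diag_mx _ *m _); apply/rowP => i.
  by rewrite !mxE qai -expr2 sqrtCK.
Qed.

(** The matrix is [1 + (z - 1) p] for the orthogonal projection [p] on the line of
    [v], so it acts as [z] on this line and as [1] on its complement. *)
Lemma unitary_rank1 n (v : 'cV[C]_n) (z : C) : `|z| = 1 -> v != 0 ->
  1%:M + ((z - 1) / (v^t* *m v) 0 0) *: (v *m v^t*) \is unitarymx.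
Proof.
set c := (v^t* *m v) 0 0; move=> z1 v0.
have cE : c = \sum_k `|v k 0| ^+ 2.
  by rewrite /c mxE; apply: eq_bigr => k _; rewrite !mxE mulrC -normCK.
have c0 : 0 <= c by rewrite cE sumr_ge0// => k _; rewrite exprn_ge0.
have vv : c != 0.
  apply: contra_neq v0; rewrite cE => /psumr_eq0P E; apply/colP => k; rewrite mxE.
  by apply/eqP; rewrite -normr_eq0 -sqrf_eq0 E// => i _; rewrite exprn_ge0.
set p := c^-1 *: (v *m v^t*).
have pp : p *m p = p.
  rewrite /p -scalemxAl -scalemxAr -(mulmxA v) (mulmxA _ v).
  rewrite [v^t* *m v]mx11_scalar -/c mul_scalar_mx -scalemxAr.
  by rewrite (scalerA c^-1 c) mulVf// scale1r.
have pa : p^t* = p.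
  rewrite /p linearZ /= map_mxZ adjM trmxCK; congr (_ *: _).
  by apply/CrealP/ger0_real; rewrite invr_ge0.
rewrite -scalerA -/p; clearbody p; apply/unitarymxP.
have -> : (1%:M + (z - 1) *: p)^t* = 1%:M + (z^* - 1) *: p.
  rewrite linearD linearZ /= map_mxD map_mxZ pa trmx1 map_mx1.
  by rewrite rmorphB /= conjC1.
have zz : z * z^* = 1 by rewrite -normCK z1 expr1n.
rewrite mulmxDl mul1mx mulmxDr mulmx1 -scalemxAl -scalemxAr pp scalerA.
have z0 : z^* - 1 + (z - 1 + (z - 1) * (z^* - 1)) = 0.
  rewrite mulrBr mulrBl zz mulr1 mul1r -[(1 - _) - _]addrA -opprD; ring.
by rewrite -addrA -!scalerDl z0 scale0r addr0.
Qed.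

End Spectral.

Section Gauss.
Variable R : realType.
Local Notation C := R[i].

(** A complex number of modulus 1 that is not a root of unity. It serves twice: its
    powers are infinitely many points of the circle, and they separate the degrees. *)
Definition gauss : C := Complex (3 / 5) (4 / 5).

Lemma gauss_norm : `|gauss| = 1.
Proof.
rewrite normc_def /= -[RHS]/((1 : R)%:C)%C; congr (_ %:C)%C.
by rewrite (_ : _ + _ = 1) ?sqrtr1//; field.
Qed.

Lemma gauss_neq0 : gauss != 0.
Proof. by rewrite -normr_gt0 gauss_norm ltr01. Qed.

(** Modulo 5 the number 3 + 4i is idempotent, so that the imaginary parts of its
    powers are all 4 modulo 5 and no power is real. *)
Lemma gauss_pow k : exists a b : int,
  (gauss * 5) ^+ k.+1 = Complex ((5 * a + 3)%:~R) ((5 * b + 4)%:~R).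
Proof.
have -> : gauss * 5 = Complex 3 4.
  have -> : (5 : C) = Complex 5 0 by rewrite -(rmorph_nat (real_complex R)).
  by rewrite /gauss; congr Complex; simpl; field.
elim: k => [|k [a [b IH]]].
  by exists 0, 0; rewrite expr1 !mulr0 !add0r.
exists (3 * a - 4 * b - 2), (4 * a + 3 * b + 4).
rewrite exprS IH; congr Complex; rewrite /=.
  by rewrite -[3 : R]/(3%:~R) -[4 : R]/(4%:~R) -!intrM -intrB; congr intmul; ring.
by rewrite -[3 : R]/(3%:~R) -[4 : R]/(4%:~R) -!intrM -intrD; congr intmul; ring.
Qed.

Lemma gauss_inj : injective (fun k => gauss ^+ k).
Proof.
have no1 k : gauss ^+ k.+1 <> 1.
  move=> zk; have [a [b]] := gauss_pow k.
  rewrite exprMn zk mul1r => /(congr1 (@complex.Im _)) /=.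
  have -> : (5 : C) = (5 : R)%:C%C by rewrite (rmorph_nat (real_complex R)).
  rewrite -rmorphXn /= => /esym/eqP; rewrite intr_eq0; lia.
move=> j k; wlog jk : j k / (j <= k)%N.
  by move=> H; case: (leqP j k) => [/H//|/ltnW/H{}H /esym/H].
move: jk; rewrite leq_eqVlt => /predU1P[//|jk] /= /esym.
rewrite -(subnK jk) addnS -addSn exprD -[RHS]mul1r => /mulIf H.
by case: (no1 (k - j.+1)%N); apply: H; rewrite expf_neq0// gauss_neq0.
Qed.

End Gauss.

Section Inner.
Variable R : realType.
Local Notation C := R[i].

Lemma innerDl d (u v w : 'cV[C]_d) : inner (u + v) w = inner u w + inner v w.
Proof. by rewrite /inner mulmxDr mxE. Qed.
Lemma innerZl d a (u w : 'cV[C]_d) : inner (a *: u) w = a * inner u w.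
Proof. by rewrite /inner -scalemxAr mxE. Qed.
Lemma inner_conj d (u v : 'cV[C]_d) : (inner u v)^* = inner v u.
Proof.
rewrite !innerE rmorph_sum; apply: eq_bigr => k _.
by rewrite rmorphM /= conjCK mulrC.
Qed.
Lemma innerDr d (u v w : 'cV[C]_d) : inner w (u + v) = inner w u + inner w v.
Proof. by rewrite -inner_conj innerDl rmorphD /= !inner_conj. Qed.
Lemma innerZr d a (u w : 'cV[C]_d) : inner w (a *: u) = a^* * inner w u.
Proof. by rewrite -inner_conj innerZl rmorphM /= inner_conj. Qed.
Lemma inner_suml d I (r : seq I) (P : pred I) (F : I -> 'cV[C]_d) w :
  inner (\sum_(i <- r | P i) F i) w = \sum_(i <- r | P i) inner (F i) w.
Proof.
apply: (big_morph (fun u => inner u w)) => [u v|]; first exact: innerDl.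
by rewrite -(scale0r 0) innerZl mul0r.
Qed.
Lemma inner_sumr d I (r : seq I) (P : pred I) (F : I -> 'cV[C]_d) w :
  inner w (\sum_(i <- r | P i) F i) = \sum_(i <- r | P i) inner w (F i).
Proof.
apply: (big_morph (fun u => inner w u)) => [u v|]; first exact: innerDr.
by rewrite -(scale0r 0) innerZr conjC0 mul0r.
Qed.
Lemma inner_adj p q (A : 'M[C]_(p, q)) u v :
  inner (A *m u) v = inner u (A^t* *m v).
Proof. by rewrite /inner trmx_mul map_mxM trmxCK mulmxA. Qed.
Lemma inner_ge0 d (u : 'cV[C]_d) : 0 <= inner u u.
Proof.
by rewrite innerE sumr_ge0// => k _; rewrite mulrC mul_conjC_ge0.
Qed.

Lemma inner_eq0 d (u : 'cV[C]_d) : inner u u = 0 -> u = 0.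
Proof.
rewrite innerE => u0; apply/colP => k; rewrite mxE.
have /psumr_eq0P/(_ u0)/(_ k isT)/eqP : forall i, true -> 0 <= (u i 0)^* * u i 0.
  by move=> i _; rewrite mulrC mul_conjC_ge0.
by rewrite mulf_eq0 conjC_eq0 orbb => /eqP.
Qed.

Lemma quadratic_eq0 d (B : 'M[C]_d) :
  (forall v, inner (B *m v) v = 0) -> B = 0.
Proof.
move=> B0.
have pol u v : inner (B *m u) v = 0.
  have H c : c^* * inner (B *m u) v + c * inner (B *m v) u = 0.
    have := B0 (u + c *: v); rewrite mulmxDr innerDl !innerDr -!scalemxAr.
    by rewrite !innerZl !innerZr !B0 !mulr0 addr0 add0r.
  have := H 1; rewrite conjC1 !mul1r => /eqP; rewrite addr_eq0 => /eqP E.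
  have := H 'i; rewrite conjCi mulNr E mulrN opprK -mulr2n => /eqP.
  by rewrite mulrn_eq0/= mulf_eq0 (negbTE (neq0Ci _))/= => /eqP ->; rewrite oppr0.
by apply/matrixP => p q; rewrite -inner_delta pol mxE.
Qed.

Lemma psdmx_adj d (A : 'M[C]_d) : psdmx A -> A^t* = A.
Proof.
move=> Apos; apply/eqP; rewrite -subr_eq0; apply/eqP; apply: quadratic_eq0 => v.
rewrite mulmxBl -[- (A *m v)]scaleN1r innerDl innerZl mulN1r.
have -> : inner (A^t* *m v) v = (inner (A *m v) v)^*.
  by rewrite inner_conj (inner_adj (A^t*)) trmxCK.
by rewrite (CrealP (ger0_real (Apos v))) subrr.
Qed.

End Inner.

(** * Schur-Weyl duality for the unitary group *)

Section GroupSpan.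
Variables (R : realType) (n : nat).
Local Notation C := R[i].
Local Notation G := 'U[R]_n.

Implicit Types (pi : unitary_rep R n) (c : seq (C * G)).

(** The value in [pi] of the element of the group algebra with the listed
    coefficients and group elements. *)
Definition galg pi c : 'M[C]_(rdim pi) := \sum_(p <- c) p.1 *: pi p.2.

(** The image of the group algebra under [pi]. *)
Definition gspan pi (X : 'M[C]_(rdim pi)) : Prop := exists c, X = galg pi c.

Lemma gspan_rep pi t : gspan (pi t).
Proof. by exists [:: (1, t)]; rewrite /galg big_seq1 scale1r. Qed.

Lemma gspan_linear_pred pi : linear_pred (@gspan pi).
Proof.
split=> [|a X Y [c ->] [d ->]]; first by exists [::]; rewrite /galg big_nil.
exists ([seq (a * p.1, p.2) | p <- c] ++ d); rewrite /galg big_cat big_map scaler_sumr.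
by congr (_ + _); apply: eq_bigr => p _; rewrite scalerA.
Qed.

Lemma gspan1 pi : @gspan pi 1%:M.
Proof. by rewrite -(rmx1 pi); exact: gspan_rep. Qed.

Lemma gspanM pi X Y : @gspan pi X -> @gspan pi Y -> @gspan pi (X *m Y).
Proof.
have Plin := gspan_linear_pred pi.
move=> [c ->] [d ->]; rewrite {1}/galg mulmx_suml; apply: (linear_pred_sum Plin) => p _.
rewrite /galg mulmx_sumr; apply: (linear_pred_sum Plin) => q _.
rewrite -scalemxAl -scalemxAr -rmxM.
by do 2 apply: (linear_predZ _ Plin); exact: gspan_rep.
Qed.

End GroupSpan.

Section SchurWeyl.
Variables (R : realType) (n l : nat).
Local Notation C := R[i].
Local Notation G := 'U[R]_n.
Implicit Types (x e b : 'I_l -> 'M[C]_n).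

Local Notation P := (@gspan R n (tpow_rep R n l)).

Lemma eq_etens x b : x =1 b -> etens x = etens b.
Proof. by move=> xb; congr etens; exact/funext. Qed.

Definition subst x (j : 'I_l) (y : 'M[C]_n) : 'I_l -> 'M[C]_n :=
  fun k => if k == j then y else x k.

Lemma etens_linear x j : linear (fun y => etens (subst x j y)).
Proof.
have E y p q : etens (subst x j y) p q = y (mindex p j) (mindex q j) *
    \prod_(k < l | k != j) x k (mindex p k) (mindex q k).
  rewrite mxE (bigD1 j)//= /subst eqxx; congr (_ * _).
  by apply: eq_bigr => k /negbTE ->.
move=> c y z; apply/matrixP => p q.
transitivity (c * etens (subst x j y) p q + etens (subst x j z) p q); last first.
  by rewrite !mxE.
by rewrite !E 2!mxE mulrDl mulrA.
Qed.

Lemma etens_addZ e b (s : C) :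
  etens (fun k => s *: e k + b k) =
  \sum_(J : {set 'I_l}) s ^+ #|J| *: etens (fun k => if k \in J then e k else b k).
Proof.
apply/matrixP => p q; rewrite summxE !mxE.
under eq_bigr do rewrite 2!mxE.
rewrite bigA_distr; apply: eq_bigr => J _; rewrite !mxE.
rewrite (bigID (mem J))/= [in RHS](bigID (mem J))/= mulrA; congr (_ * _).
  rewrite -prodr_const -big_split; apply: eq_bigr => k kJ /=; rewrite kJ //.
by apply: eq_bigr => k /negbTE ->.
Qed.

(** The symmetrization of an elementary tensor, up to the factor [l!]. *)
Definition symt x : 'M[C]_(tdim n l) := \sum_(s : 'S_l) etens (fun k => x (s k)).

Lemma eq_symt x b : x =1 b -> symt x = symt b.
Proof. by move=> xb; congr symt; exact/funext. Qed.

Lemma symt_perm x (t : 'S_l) : symt (fun k => x (t k)) = symt x.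
Proof.
rewrite [RHS]/symt (reindex_inj (mulIg t)); apply: eq_bigr => s _.
by apply: eq_etens => k; rewrite permM.
Qed.

Lemma symt_linear x j : linear (fun y => symt (subst x j y)).
Proof.
move=> c y z; rewrite /symt scaler_sumr -big_split; apply: eq_bigr => s _ /=.
have E w : etens (fun k => subst x j w (s k)) =
    etens (subst (fun k => x (s k)) (s^-1 j)%g w).
  by apply: eq_etens => k; rewrite /subst (canF_eq (permK s)).
by rewrite !E etens_linear.
Qed.

Lemma symt0 x j : symt (subst x j 0) = 0.
Proof. by have := symt_linear x j (-1) 0 0; rewrite scaler0 addr0 scaleN1r addNr. Qed.

(** Expanding [s e + b] in all slots gives a polynomial in [s]. Its linear coefficient
    sums the tensors with [e] in one slot and [b] in all others. *)
Lemma symt_addZ e b (j0 : 'I_l) : exists v : 'I_l.+1 -> 'M[C]_(tdim n l),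
  (forall s : C, symt (fun k => s *: e k + b k) = \sum_(i < l.+1) s ^+ i *: v i) /\
  exists i, v i = \sum_k symt (subst b k (e k)).
Proof.
(* [J] is the set of the slots that take the summand [s e]. *)
pose mix (J : {set 'I_l}) (s : 'S_l) k := if k \in J then e (s k) else b (s k).
pose v (i : 'I_l.+1) := \sum_(s : 'S_l) \sum_(J : {set 'I_l} | #|J| == i) etens (mix J s).
exists v; split=> [z|].
  rewrite /symt; under [RHS]eq_bigr do rewrite /v scaler_sumr.
  rewrite exchange_big /=; apply: eq_bigr => s _.
  rewrite (etens_addZ (fun k => e (s k)) (fun k => b (s k))).
  have cardJ (J : {set 'I_l}) : (#|J| < l.+1)%N.
    by rewrite ltnS (leq_trans (max_card _))// card_ord.
  rewrite (partition_big (fun J : {set 'I_l} => Ordinal (cardJ J)) xpredT)//=.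
  apply: eq_bigr => i _; rewrite scaler_sumr; apply: eq_big => [J|J /eqP <-//].
  by rewrite -val_eqE.
have l1 : (1 < l.+1)%N by rewrite ltnS (leq_ltn_trans _ (ltn_ord j0)).
exists (Ordinal l1); rewrite /v /symt [RHS]exchange_big /=; apply: eq_bigr => s _.
rewrite (reindex_onto (fun k : 'I_l => [set k]%SET)
    (fun J : {set 'I_l} => odflt j0 [pick k in J])).
  rewrite (reindex_inj (@perm_inj _ s^-1)%g); apply: eq_big => [k|k _].
    rewrite cards1 eqxx; case: pickP => [k'|/(_ (s^-1 k)%g)]; rewrite !inE ?eqxx//.
  apply: eq_etens => k'; rewrite /mix inE /subst (canF_eq (permK s)).
  by case: eqP => // ->; rewrite permKV.
move=> J /cards1P[k ->]; case: pickP => [k'|/(_ k)]; rewrite !inE ?eqxx//.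
by move=> /eqP ->.
Qed.

(** The factors halfway through the induction of [symt_gspan]: the slots before [j]
    have been freed, the others still hold the unitary matrix [u]. *)
Definition upto (j : nat) x (u : 'M[C]_n) : 'I_l -> 'M[C]_n :=
  fun k => if (k < j)%N then x k else u.

(** The matrix [1 + s v v^t] (with the adjoint [v^t] of [v]) is unitary for infinitely
    many [s], and along [u (1 + s v v^t)] the symmetrization is a polynomial in [s]
    with values in the span; so its linear coefficient is in the span. By symmetry
    this coefficient is a multiple of the tensor with [u v v^t] in the slot [j]. *)
Lemma symt_step (j : 'I_l) x u (v : 'cV[C]_n) : u \is unitarymx ->
    (forall u', u' \is unitarymx -> P (symt (upto j x u'))) ->
  P (symt (subst (upto j x u) j (u *m (v *m v^t*)))).
Proof.
move=> uU IH; have Psub := gspan_linear_pred (tpow_rep R n l).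
have [->|v0] := eqVneq v 0; first by rewrite mul0mx mulmx0 symt0; case: Psub.
set y := u *m _; set b := upto j x u.
pose e (k : 'I_l) := if (k < j)%N then 0 else y.
have [w [wE [i wi]]] := symt_addZ e b j.
have Pw : P (w i).
  apply: (linear_pred_coef Psub (z := fun k => (gauss R ^+ k - 1) / (v^t* *m v) 0 0)).
    move=> k k' /mulIf H; apply: (@gauss_inj R); apply: (addIr (-1)); apply: H.
    by rewrite invr_eq0; apply: contra_neq v0; exact: inner_eq0.
  move=> k; rewrite -wE.
  rewrite (eq_symt (b := upto j x (u *m (1%:M +
      ((gauss R ^+ k - 1) / (v^t* *m v) 0 0) *: (v *m v^t*))))).
    apply: IH; apply: (mul_unitarymx uU (unitary_rank1 _ v0)).
    by rewrite normrX gauss_norm expr1n.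
  move=> k'; rewrite /e /b /upto; case: ifP => _; first by rewrite scaler0 add0r.
  by rewrite mulmxDr mulmx1 -scalemxAr addrC.
(* The slots before [j] contribute 0, and the others all contribute the same. *)
have we : w i = symt (subst b j y) *+ #|[pred k : 'I_l | (j <= k)%N]|.
  rewrite wi (bigID [pred k : 'I_l | (j <= k)%N])/= [X in _ + X]big1 => [|k].
    rewrite addr0 -sumr_const; apply: eq_bigr => k jk.
    rewrite /e ltnNge jk/= -[RHS](symt_perm _ (tperm j k)); apply: eq_symt => k'.
    rewrite /subst /b /upto; case: tpermP => [->|->|/eqP k'j /eqP k'k].
    - by case: eqVneq => [//|_]; rewrite ltnn ltnNge jk.
    - by rewrite !eqxx.
    - by rewrite (negbTE k'j) (negbTE k'k).
  by rewrite -ltnNge => kj; rewrite /e kj symt0.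
have : P ((#|[pred k : 'I_l | (j <= k)%N]|%:R)^-1 *: w i) by exact: linear_predZ.
rewrite we -[symt _ *+ _]scaler_nat scalerA mulVf ?scale1r// pnatr_eq0 -lt0n.
by apply/card_gt0P; exists j; rewrite inE.
Qed.

(** The slots are freed one at a time. With [u] in all slots, the tensor is a multiple
    of the representation at [u]; and to put an arbitrary [z] into a slot is to
    put [u (u^-1 z)] there, where [u^-1 z] is a combination of matrices of rank one. *)
Lemma symt_gspan x : P (symt x).
Proof.
have Psub := gspan_linear_pred (tpow_rep R n l).
suff H j : (j <= l)%N -> forall z u, u \is unitarymx -> P (symt (upto j z u)).
  rewrite (eq_symt (b := upto l x 1%:M)); first exact: H (unitary1 R n).
  by move=> k; rewrite /upto ltn_ord.
elim: j => [_ z u uU|j IH jl z u uU].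
  apply: (linear_pred_sum Psub) => s _.
  rewrite (eq_etens (b := fun=> fund_rep R n (mkU uU)))//.
  exact: gspan_rep (tpow_rep R n l) (mkU uU).
pose o := Ordinal jl.
have Q : linear_pred (fun y => P (symt (subst (upto j z u) o (u *m y)))).
  split; first by rewrite mulmx0 symt0; case: Psub.
  move=> c y y' Py Py'; rewrite mulmxDr -scalemxAr symt_linear.
  by case: Psub => _; exact.
have H : P (symt (subst (upto j z u) o (u *m (u^t* *m z o)))).
  apply: (linear_pred_rank1 Q) => v; apply: symt_step => // u' u'U.
  by apply: IH => //; exact: ltnW.
move: H.
have uu : u *m u^t* = 1%:M by apply/unitarymxP.
rewrite mulmxA uu mul1mx.
rewrite (eq_symt (x := subst _ _ _) (b := upto j.+1 z u)).
  by [].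
move=> k; rewrite /subst /upto [(k < j.+1)%N]ltnS [(k <= j)%N]leq_eqVlt -val_eqE /=.
case: eqVneq => //= kj; congr (z _); exact/val_inj/esym.
Qed.

Lemma tactionD sigma (X Y : 'M[C]_(tdim n l)) c :
  taction sigma (c *: X + Y) = c *: taction sigma X + taction sigma Y.
Proof. by apply/matrixP => p q; rewrite !mxE. Qed.

Lemma etens_delta (p q : 'I_(tdim n l)) :
  delta_mx p q = etens (fun k => delta_mx (mindex p k) (mindex q k)) :> 'M[C]_(tdim n l).
Proof.
have E (p' q' : 'I_(tdim n l)) : (p' == q') = [forall k, mindex p' k == mindex q' k].
  rewrite -(can_eq (@mindexK n l)); apply/eqP/forallP => [-> //|H].
  by apply/ffunP => k; apply/eqP.
apply/matrixP => a b; rewrite !mxE !E.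
have [|/forallPn[k ak]] := boolP [forall k, mindex a k == mindex p k].
  move=> /forallP ap.
  have [/forallP bq|/forallPn[k bk]] := boolP [forall k, mindex b k == mindex q k].
    by rewrite big1// => k _; rewrite mxE (eqP (ap k)) (eqP (bq k)) !eqxx.
  by rewrite (bigD1 k)//= mxE (negbTE bk) andbF mul0r.
by rewrite (bigD1 k)//= mxE (negbTE ak) mul0r.
Qed.

(** A fixed point is its own average, hence a combination of symmetrized elementary
    tensors. *)
Theorem schur_weyl (X : 'M[C]_(tdim n l)) :
  (forall sigma, taction sigma X = X) -> P X.
Proof.
move=> Xsym; have Psub := gspan_linear_pred (tpow_rep R n l).
have tsum sigma : taction sigma X = \sum_p \sum_q X p q *:
    etens (fun k => delta_mx (mindex p (sigma k)) (mindex q (sigma k))).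
  have tS I (r : seq I) (F : I -> 'M[C]_(tdim n l)) :
      taction sigma (\sum_(i <- r) F i) = \sum_(i <- r) taction sigma (F i).
    apply: (big_morph (taction sigma)) => [A B|]; last first.
      by apply/matrixP => p q; rewrite !mxE.
    by rewrite -[A]scale1r tactionD !scale1r.
  rewrite {1}[X]matrix_sum_delta tS; apply: eq_bigr => p _; rewrite tS.
  apply: eq_bigr => q _; rewrite -[X p q *: delta_mx p q]addr0 tactionD.
  rewrite etens_delta taction_etens [taction _ 0](_ : _ = 0) ?addr0//.
  by apply/matrixP => a b; rewrite !mxE.
have symX : \sum_(s : 'S_l) taction s X = \sum_p \sum_q X p q *:
    symt (fun k => delta_mx (mindex p k) (mindex q k)).
  under eq_bigr do rewrite tsum.
  rewrite exchange_big /=; apply: eq_bigr => p _.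
  by rewrite exchange_big /=; apply: eq_bigr => q _; rewrite scaler_sumr.
have : P (#|'S_l|%:R^-1 *: \sum_(s : 'S_l) taction s X).
  apply: (linear_predZ _ Psub); rewrite symX.
  apply: (linear_pred_sum Psub) => p _; apply: (linear_pred_sum Psub) => q _.
  by apply: (linear_predZ _ Psub); exact: symt_gspan.
under eq_bigr do rewrite Xsym.
rewrite sumr_const -[X *+ _]scaler_nat scalerA mulVf ?scale1r//.
by rewrite pnatr_eq0 -lt0n; apply/card_gt0P; exists 1%g.
Qed.

End SchurWeyl.

(** * Positive block matrices *)

Section BlockPositivity.
Variables (R : realType) (m d : nat).
Local Notation C := R[i].

Lemma inner_mxcol (u v : 'I_m -> 'cV[C]_d) :
  inner (\mxcol_i u i) (\mxcol_i v i) = \sum_i inner (u i) (v i).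
Proof.
rewrite /inner tr_mxcol.
have -> : map_mx Num.conj (\mxrow_i (v i)^T) = \mxrow_i (v i)^t*.
  by apply/matrixP => p q; rewrite !mxE.
by rewrite mul_mxrow_mxcol summxE.
Qed.

Lemma psdblockP (x : 'M['M[C]_d]_m) :
  psdblock x <->
  forall v : 'I_m -> 'cV[C]_d, 0 <= \sum_i \sum_j inner (x i j *m v j) (v i).
Proof.
have E v : inner ((\mxblock_(i < m, j < m) x i j) *m (\mxcol_i v i)) (\mxcol_i v i) =
    \sum_i \sum_j inner (x i j *m v j) (v i).
  rewrite mul_mxblock_mxrow inner_mxcol; apply: eq_bigr => i _.
  by rewrite inner_suml.
split=> [xpos v|xpos v]; first by rewrite -E.
by rewrite -[v]submxcolK E.
Qed.

Lemma psdblockD (x y : 'M['M[C]_d]_m) : psdblock x -> psdblock y -> psdblock (x + y).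
Proof.
move=> /psdblockP xp /psdblockP yp; apply/psdblockP => v.
have := addr_ge0 (xp v) (yp v); rewrite -big_split /=.
congr (0 <= _); apply: eq_bigr => i _; rewrite -big_split; apply: eq_bigr => j _.
by rewrite mxE mulmxDl innerDl.
Qed.

Lemma psdblock0 : psdblock (0 : 'M['M[C]_d]_m).
Proof.
apply/psdblockP => v; rewrite big1// => i _; rewrite big1// => j _.
by rewrite mxE mul0mx -[0](scale0r 0) innerZl mul0r.
Qed.

Lemma psdblock_sum I (r : seq I) (F : I -> 'M['M[C]_d]_m) :
  (forall i, psdblock (F i)) -> psdblock (\sum_(i <- r) F i).
Proof.
move=> Fp; elim/big_ind: _ => [|x y xp yp|i _]; last exact: Fp.
  exact: psdblock0.
exact: psdblockD.
Qed.

End BlockPositivity.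

Section Factorisation.
Variables (R : realType) (n m : nat).
Local Notation C := R[i].
Local Notation G := 'U[R]_n.

(** The square root of [w], taken in the algebra of the block matrices whose blocks
    lie in the image of the group algebra, is the image of a matrix over the group
    algebra. *)
Lemma psdblock_gspan (pi : unitary_rep R n) (w : 'M['M[C]_(rdim pi)]_m) :
    psdblock w -> (forall i j, @gspan R n pi (w i j)) ->
  exists c : 'I_m -> 'I_m -> seq (C * G),
    forall i j, w i j = \sum_k (galg pi (c k i))^t* *m galg pi (c k j).
Proof.
move=> wpos wspan; pose d (_ : 'I_m) := rdim pi.
pose P (X : 'M[C]_(\sum_i d i)) := forall i j, @gspan R n pi (submxblock X i j).
have Plin := @gspan_linear_pred R n pi.
have [S [PS Sadj SS]] : exists S, [/\ P S, S^t* = S & \mxblock_(i, j) w i j = S *m S].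
  apply: psd_sqrt.
  - split=> [i j|a X Y PX PY i j]; first by rewrite submxblock0; case: Plin.
    have -> : submxblock (a *: X + Y) i j = a *: submxblock X i j + submxblock Y i j.
      by apply/matrixP => p q; rewrite !mxE.
    by case: Plin => _; apply; [exact: PX|exact: PY].
  - move=> i j; rewrite -mxdiagZ /mxdiag mxblockK; case: eqVneq => [->|_].
      by rewrite conform_mx_id; exact: gspan1.
    by case: Plin.
  - move=> X Y PX PY i j; rewrite -[X]submxblockK -[Y]submxblockK mul_mxblock mxblockK.
    by apply: (linear_pred_sum Plin) => k _; apply: gspanM; [exact: PX|exact: PY].
  - by move=> i j; rewrite mxblockK; exact: wspan.
  - exact: psdmx_adj.
  - exact: wpos.
have /choice[c0 c0E] : forall ij : 'I_m * 'I_m, exists c, submxblock S ij.1 ij.2 = galg pi c.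
  by move=> [i j]; exact: PS.
exists (fun k i => c0 (k, i)) => i j.
have -> : w i j = submxblock (\mxblock_(i, j) w i j) i j by rewrite mxblockK.
rewrite SS -{1}Sadj -[S]submxblockK.
have -> : (\mxblock_(i, j) submxblock S i j)^t* =
    \mxblock_(i < m, j < m) (submxblock S j i)^t*.
  by apply/matrixP => p q; rewrite !mxE.
rewrite mul_mxblock mxblockK; apply: eq_bigr => k _.
by rewrite -!c0E.
Qed.

End Factorisation.

(** * Functionals on the matrix coefficients *)

Section Duality.
Variables (R : realType) (n : nat).
Local Notation C := R[i].
Local Notation G := 'U[R]_n.
Local Notation A := (polyfun R n).
Local Notation U := (Udual R n).
Implicit Types (pi : unitary_rep R n) (f g h : A) (x y : U).

(** Induction over a spanning set: what is linear need only be checked on matrix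
    coefficients. *)
Lemma polyfun_ind (P : A -> Prop) : linear_pred P ->
  (forall pi (xi eta : 'cV[C]_(rdim pi)), P (pcoef xi eta)) -> forall f, P f.
Proof.
move=> [P0 PD] Pc f; have /polyfunP[k [a [F [FP fE]]]] := valP f.
suff [g [gE Pg]] : exists g : A, pfun g = \sum_(i < k) a i *: F i /\ P g.
  by rewrite (_ : f = g)//; apply: val_inj; rewrite /= fE gE.
apply: (big_ind (fun F : G -> C => exists g : A, pfun g = F /\ P g)).
- by exists 0.
- move=> _ _ [g [<- Pg]] [h [<- Ph]]; exists (g + h); split=> //.
  by rewrite -[g]scale1r; exact: PD.
- move=> i _; have [pi [xi [eta ->]]] := FP i; exists (a i *: pcoef xi eta).
  by split=> //; rewrite -[_ *: _]addr0; exact: PD.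
Qed.

Definition dual_of (f : A -> C) (fL : scalar f) : U :=
  HB.pack f (GRing.isLinear.Build C A C *%R f fL).

Lemma UextD pi x y : Uext pi (x + y) = Uext pi x + Uext pi y.
Proof. by apply/matrixP => p q; rewrite !mxE. Qed.

Lemma UextB pi x y : Uext pi (x - y) = Uext pi x - Uext pi y.
Proof. by apply/matrixP => p q; rewrite !mxE. Qed.

Lemma Uext0 pi : Uext pi 0 = 0.
Proof. by apply/matrixP => p q; rewrite !mxE. Qed.

Lemma Uext_eq pi x (X : 'M[C]_(rdim pi)) :
  (forall xi eta, x (pcoef xi eta) = inner (X *m xi) eta) -> Uext pi x = X.
Proof. by move=> H; apply/matrixP => p q; rewrite mxE H inner_delta. Qed.

Section GroupAlgebra.

(** Evaluation at the element [sum_k c_k^adj d_k] of the group algebra, where the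
    adjoint conjugates the coefficients and inverts the group elements. *)
Definition point_form (I : finType) (c d : I -> seq (C * G)) f : C :=
  \sum_k \sum_(p <- c k) \sum_(q <- d k) p.1^* * q.1 * f (p.2^-1 * q.2)%g.

Lemma point_form_scalar I c d : scalar (@point_form I c d).
Proof.
move=> a f g; rewrite /point_form mulr_sumr -big_split; apply: eq_bigr => k _ /=.
rewrite mulr_sumr -big_split; apply: eq_bigr => p _ /=.
rewrite mulr_sumr -big_split; apply: eq_bigr => q _ /=.
set t := (_ * _)%g; rewrite -[LHS]/(p.1^* * q.1 * (a * f t + g t)).
by rewrite mulrDr mulrCA.
Qed.

Definition point_dual (I : finType) (c d : I -> seq (C * G)) : U :=
  dual_of (@point_form_scalar I c d).

Lemma repV pi t : pi (t^-1)%g = (pi t)^t*.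
Proof.
have H : pi t *m pi (t^-1)%g = 1%:M by rewrite -rmxM mulgV rmx1.
by rewrite -[LHS]mul1mx -(mulmx1C (unitarymxP (rmxU pi t))) -mulmxA H mulmx1.
Qed.

Lemma Uext_point_dual pi (I : finType) (c d : I -> seq (C * G)) :
  Uext pi (point_dual c d) = \sum_k (galg pi (c k))^t* *m galg pi (d k).
Proof.
apply: Uext_eq => xi eta; rewrite mulmx_suml inner_suml; apply: eq_bigr => k _.
rewrite -mulmxA inner_adj trmxCK.
rewrite /galg mulmx_suml inner_suml.
under [RHS]eq_bigr do rewrite mulmx_suml inner_sumr.
rewrite exchange_big /=; apply: eq_bigr => p _; apply: eq_bigr => q _.
rewrite -!scalemxAl innerZl innerZr mulrCA mulrA; congr (_ * _).
by rewrite /coef rmxM repV -mulmxA inner_adj trmxCK.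
Qed.

End GroupAlgebra.

End Duality.

(** * Translation by a central element *)

Section CentralTranslation.
Variables (R : realType) (n : nat).
Local Notation C := R[i].
Local Notation G := 'U[R]_n.
Local Notation A := (polyfun R n).
Local Notation U := (Udual R n).
Implicit Types (pi : unitary_rep R n) (f g h : A) (x y : U).
Local Notation z := (gauss R).

Fact central_subproof : z%:M \is @unitarymx C n n.
Proof.
apply/unitarymxP; rewrite tr_scalar_mx map_scalar_mx -scalar_mxM -normCK.
by rewrite gauss_norm expr1n.
Qed.

(** Of infinite order, since [z] is not a root of unity. *)
Definition central : G := mkU central_subproof.

Lemma centralC t : (t * central = central * t)%g.
Proof. by apply: umx_inj; rewrite /umx /= scalar_mxC. Qed.

Lemma translate_poly f : (fun t => f (t * central)%g) \in @polyfun_pred R n.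
Proof.
apply: (polyfun_ind (P := fun f => (fun t => f (t * central)%g) \in @polyfun_pred R n)).
  split=> [|a g h gP hP]; first exact: rpred0.
  have -> : (fun t => (a *: g + h) (t * central)%g) =
    a *: (fun t => g (t * central)%g) + (fun t => h (t * central)%g) by [].
  by rewrite rpredD// rpredZ.
move=> pi xi eta.
have -> : (fun t => pcoef xi eta (t * central)%g) = coef (pi central *m xi) eta.
  by apply/funext => t; rewrite /= /coef rmxM mulmxA.
exact: Defs.coef_poly.
Qed.

Definition translate f : A := Polyfun (translate_poly f).

Fact translate_linear : linear translate.
Proof. by move=> a f g; apply: pfun_inj. Qed.
HB.instance Definition _ :=
  GRing.isLinear.Build C A A _ translate translate_linear.

Lemma translate_pcoef pi (xi eta : 'cV[C]_(rdim pi)) :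
  translate (pcoef xi eta) = pcoef (pi central *m xi) eta.
Proof. by apply: pfun_inj => t; rewrite /= /coef rmxM mulmxA. Qed.

Lemma translateM f g : translate (pmul f g) = pmul (translate f) (translate g).
Proof. exact: pfun_inj. Qed.

Lemma translate_frho rho : translate (frho rho) = z *: frho rho.
Proof.
apply: pfun_inj => t; rewrite -[RHS]/(z * rho (umx t)) -[LHS]/(rho (umx t *m z%:M)).
by rewrite mul_mx_scalar linearZ.
Qed.

Lemma translate_tpow l (xi eta : 'cV[C]_(rdim (tpow_rep R n l))) :
  translate (pcoef xi eta) = z ^+ l *: pcoef xi eta.
Proof.
have E : tpow_rep R n l central = (z ^+ l)%:M.
  apply/matrixP => p q; rewrite !mxE.
  have -> : z ^+ l *+ (p == q) = \prod_(k < l) z * (1%:M : 'M[C]_(tdim n l)) p q.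
    by rewrite prodr_const card_ord mxE mulr_natr.
  rewrite -etens1 mxE -big_split; apply: eq_bigr => k _ /=.
  by rewrite !mxE mulr_natr.
rewrite translate_pcoef E mul_scalar_mx; apply: pfun_inj => t.
by rewrite /= /coef -scalemxAr innerZl.
Qed.

Lemma pcoefDl pi (xi xi' eta : 'cV[C]_(rdim pi)) :
  pcoef (xi + xi') eta = pcoef xi eta + pcoef xi' eta.
Proof. by apply: pfun_inj => t; rewrite /= /coef mulmxDr innerDl. Qed.

Lemma pcoefZl pi a (xi eta : 'cV[C]_(rdim pi)) :
  pcoef (a *: xi) eta = a *: pcoef xi eta.
Proof. by apply: pfun_inj => t; rewrite /= /coef -scalemxAr innerZl. Qed.

(** The entries of a unitary matrix have modulus at most 1. *)
Lemma polyfun_bounded f : exists M : C, forall t, `|f t| <= M.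
Proof.
apply: (polyfun_ind (P := fun f => exists M : C, forall t, `|f t| <= M)) => [|pi xi eta].
  split=> [|a g h [M gM] [N hN]]; first by exists 0 => t; rewrite normr0.
  exists (`|a| * M + N) => t; rewrite -[(a *: g + h) t]/(a * g t + h t).
  by rewrite (le_trans (ler_normD _ _))// lerD// normrM ler_wpM2l.
exists (\sum_p \sum_q `|(eta p 0)^* * xi q 0|) => t.
rewrite /= /coef inner_mul (le_trans (ler_norm_sum _ _ _))// ler_sum// => p _.
rewrite (le_trans (ler_norm_sum _ _ _))// ler_sum// => q _.
rewrite normrM -[leRHS]mulr1 ler_wpM2l// -(@expr_le1 _ 2)//.
have /matrixP/(_ p p) := unitarymxP (rmxU pi t); rewrite !mxE eqxx => E.
rewrite -[leRHS]/(true%:R) -E (bigD1 q)//= !mxE -normCK lerDl sumr_ge0// => k _.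
by rewrite !mxE -normCK exprn_ge0.
Qed.

End CentralTranslation.

(** * The projection on the functions of a given degree *)

Lemma subr_swap (V : zmodType) (a b c d : V) : a - c = b - d + (a - b - (c - d)).
Proof. by rewrite [- (c - d)]opprD [X in _ = _ + X]addrACA -opprD [RHS]addrC subrK. Qed.

Lemma scaler_swap (K : fieldType) (V : lmodType K) (a c : K) (f u' u g v' v : V) :
  a *: (f + (u' - c *: u)) + (g + (v' - c *: v)) =
  a *: f + g + (a *: u' + v' - c *: (a *: u + v)).
Proof.
rewrite scalerDr addrACA; congr (_ + _).
by rewrite scalerBr [c *: (_ + _)]scalerDr opprD addrACA !scalerA mulrC.
Qed.

Section DegreeProjection.
Variables (R : realType) (n : nat).
Local Notation C := R[i].
Local Notation G := 'U[R]_n.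
Local Notation A := (polyfun R n).
Local Notation U := (Udual R n).
Implicit Types (pi : unitary_rep R n) (f g h : A) (x y : U).
Local Notation z := (gauss R).
Local Notation T := (@translate R n).

(** The complex order compares real parts only when the imaginary parts agree, so the
    Archimedean property has to be pulled back from the reals. *)
Lemma archimedean_eq0 (a b : C) : 0 <= a -> (forall k, a *+ k <= b) -> a = 0.
Proof.
move=> a0 ab; have := a0; rewrite lecE => /andP[/eqP Ima Rea].
have ReMn k : complex.Re (a *+ k) = complex.Re a *+ k.
  by elim: k => [//|k IH]; rewrite !mulrS -IH; case: (a) (a *+ k) => [? ?] [? ?].
have RaE k : complex.Re a *+ k <= complex.Re b.
  by have := ab k; rewrite lecE ReMn => /andP[].
apply/eqP; rewrite eq_complex Ima eqxx andbT eq_le Rea andbT leNgt.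
apply/negP => Ra_gt0.
have Rb0 : 0 <= complex.Re b by have := RaE 0%N; rewrite mulr0n.
have := Num.Theory.archi_boundP (divr_ge0 Rb0 (ltW Ra_gt0)).
by rewrite ltr_pdivrMr// mulr_natl ltNge RaE.
Qed.

(** A Jordan block is excluded by boundedness: otherwise the iterates of the
    translation, which are [al ^+ k (g + k h / al)] at [g], would grow linearly,
    while [g] is a bounded function. *)
Lemma translate_semisimple (al : C) g h : `|al| = 1 ->
  T g = al *: g + h -> T h = al *: h -> h = 0.
Proof.
move=> al1 Tg Th; have al0 : al != 0 by rewrite -normr_gt0 al1.
have [h' h'E Th'] : exists2 h' : A, h = al *: h' & T h' = al *: h'.
  exists (al^-1 *: h); first by rewrite scalerA mulfV// scale1r.
  by rewrite linearZ /= Th !scalerA mulrC.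
have Tk k : iter k T g = al ^+ k *: (g + k%:R *: h').
  elim: k => [|k IH]; first by rewrite scale0r addr0 expr0 scale1r.
  rewrite iterS IH linearZ linearD linearZ /= Tg Th' exprSr -scalerA.
  congr (_ *: _); rewrite !scalerDr -addrA; congr (_ + _).
  rewrite -[k.+1%:R]natr1 scalerDl scalerDr scale1r addrC; congr (_ + _).
    by rewrite !scalerA mulrC.
  by rewrite h'E.
rewrite h'E; have [M gM] := polyfun_bounded g.
have TM k t : `|iter k T g t| <= M.
  by elim: k t => [//|k IH] t; exact: IH.
suff -> : h' = 0 by rewrite scaler0.
apply: pfun_inj => t; apply/eqP; rewrite -[X in _ == X]/(0 : C) -normr_eq0; apply/eqP.
apply: (@archimedean_eq0 _ (M + M)) => // k.
have -> : `|h' t| *+ k = `|(g t + k%:R * h' t) - g t|.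
  by rewrite addrC addKr normrM normr_nat mulr_natl.
rewrite (le_trans (ler_normB _ _))// lerD//.
have := TM k t; rewrite Tk -[pfun _ t]/(al ^+ k * (g t + k%:R * h' t)).
by rewrite normrM normrX al1 expr1n mul1r.
Qed.

(** The component of degree [l], characterized without a choice of eigenfunctions: the
    remainder lies in the range of [translate - z ^+ l], which is the sum of the other
    eigenspaces. *)
Definition deg_part l f h : Prop :=
  T h = z ^+ l *: h /\ exists g, f = h + (T g - z ^+ l *: g).

(** The difference of two components is both an eigenfunction and in the range of
    [translate - z ^+ l], and semisimplicity forces it to vanish. *)
Lemma deg_part_uniq l f h h' : deg_part l f h -> deg_part l f h' -> h = h'.
Proof.
move=> [Th [g fE]] [Th' [g' fE']]; apply/eqP; rewrite -subr_eq0; apply/eqP.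
apply: (@translate_semisimple (z ^+ l) (g' - g)).
- by rewrite normrX gauss_norm expr1n.
- apply/eqP; rewrite linearB /= scalerBr; apply/eqP.
  have E : h - h' = (T g' - z ^+ l *: g') - (T g - z ^+ l *: g).
    by apply/eqP; rewrite subr_eq addrAC eq_sym subr_eq addrC -fE' fE.
  rewrite E; exact: subr_swap.
- by rewrite linearB /= Th Th' scalerBr.
Qed.

Lemma deg_part_linear l a f g f' g' :
  deg_part l f f' -> deg_part l g g' -> deg_part l (a *: f + g) (a *: f' + g').
Proof.
move=> [Tf [u ->]] [Tg [v ->]]; split.
  by rewrite linearD linearZ /= Tf Tg scalerDr !scalerA mulrC.
by exists (a *: u + v); rewrite linearP; exact: scaler_swap.
Qed.

(** The spectral projection of [pi central] at [z ^+ l], which is orthogonal and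
    commutes with [pi] because [central] is central. *)
Lemma deg_proj_rep pi l : exists Q : 'M[C]_(rdim pi),
  [/\ Q^t* = Q, Q *m Q = Q, forall t, Q *m pi t = pi t *m Q
    & forall xi eta, deg_part l (pcoef xi eta) (pcoef (Q *m xi) eta)].
Proof.
set a := pi (central R n).
have aN : a \is normalmx.
  apply/normalmxP; have aa := unitarymxP (rmxU pi (central R n)).
  by rewrite aa (mulmx1C aa).
have [Q [S [Qa QQ [aQ Qa'] QS SQ]]] := spectral_projection (z ^+ l) aN.
exists Q; split=> // [t|xi eta].
  set b := pi t; have ab : a *m b = b *m a by rewrite -!rmxM centralC.
  set d := a - (z ^+ l)%:M in QS SQ.
  have db : d *m b = b *m d by rewrite mulmxBl mulmxBr ab scalar_mxC.
  have dQ : d *m Q = 0 by rewrite mulmxBl aQ mul_scalar_mx subrr.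
  have Qd : Q *m d = 0 by rewrite mulmxBr Qa' mul_mx_scalar subrr.
  have bQ : b *m Q = Q *m b *m Q.
    rewrite -[LHS]mul1mx -SQ mulmxDl -[S *m d *m _]mulmxA (mulmxA d) db.
    by rewrite -(mulmxA b) dQ !mulmx0 addr0 mulmxA.
  have Qb : Q *m b = Q *m b *m Q.
    rewrite -[LHS]mulmx1 -QS mulmxDr -[Q *m b *m (d *m S)]mulmxA (mulmxA b) -db.
    by rewrite !mulmxA Qd !mul0mx addr0.
  by rewrite bQ -Qb.
split; first by rewrite translate_pcoef mulmxA aQ -scalemxAl pcoefZl.
exists (pcoef (S *m xi) eta); rewrite translate_pcoef -pcoefZl -scaleN1r -pcoefZl.
rewrite -!pcoefDl scaleN1r mulmxA -mul_scalar_mx mulmxA -mulmxBl -mulmxBl -mulmxDl.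
by rewrite QS mul1mx.
Qed.

Lemma deg_part_ex l f : exists h, deg_part l f h.
Proof.
apply: (polyfun_ind (P := fun f => exists h, deg_part l f h)) => [|pi xi eta].
  split=> [|a u v [u' up] [v' vp]]; last by exists (a *: u' + v'); exact: deg_part_linear.
  exists 0; split; rewrite ?linear0 ?scaler0//.
  by exists 0; rewrite linear0 scaler0 subrr addr0.
by have [Q [_ _ _ H]] := deg_proj_rep pi l; exists (pcoef (Q *m xi) eta).
Qed.

Definition deg_proj l f : A := sval (cid (deg_part_ex l f)).

Lemma deg_projP l f h : deg_part l f h -> deg_proj l f = h.
Proof. by apply: deg_part_uniq; rewrite /deg_proj; case: cid. Qed.

Fact deg_proj_linear l : linear (deg_proj l).
Proof.
move=> a f g; apply: deg_projP; apply: deg_part_linear;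
  by rewrite /deg_proj; case: cid.
Qed.
HB.instance Definition _ l :=
  GRing.isLinear.Build C A A _ (deg_proj l) (deg_proj_linear l).

Lemma deg_proj_id l f : T f = z ^+ l *: f -> deg_proj l f = f.
Proof.
move=> Tf; apply: deg_projP; split=> //; exists 0.
by rewrite linear0 scaler0 subrr addr0.
Qed.

(** Multiplication of [f] by [(be - z ^+ l)^-1] exhibits it in the range of
    [translate - z ^+ l]. *)
Lemma deg_proj_eq0 l (be : C) f : T f = be *: f -> be != z ^+ l -> deg_proj l f = 0.
Proof.
move=> Tf bez; apply: deg_projP; split; first by rewrite linear0 scaler0.
exists ((be - z ^+ l)^-1 *: f); rewrite linearZ /= Tf add0r !scalerA -scalerBl.
by rewrite mulrC -mulrBl mulfV ?scale1r// subr_eq0.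
Qed.

(** The part of [x] that lives on the representations on which the centre acts with
    degree [l]; there it agrees with [x], on the others it vanishes. *)
Definition Udeg l x : U := x \o deg_proj l.

Lemma UdegE l x f : Udeg l x f = x (deg_proj l f).
Proof. by []. Qed.

Lemma Uext_Udeg_tpow j l x : Uext (tpow_rep R n j) (Udeg l x) =
  if j == l then Uext (tpow_rep R n j) x else 0.
Proof.
apply/matrixP => p q; rewrite [LHS]mxE UdegE.
have Tp := translate_tpow (delta_mx q 0) (delta_mx p 0).
case: eqVneq => [jl|jl].
  by rewrite deg_proj_id; [rewrite mxE | rewrite -jl].
rewrite (deg_proj_eq0 Tp) ?linear0 ?mxE//.
by apply: contra_neq jl => /gauss_inj.
Qed.

(** In a representation, [Udeg] multiplies by a projection [Q] that commutes with
    the image of [x]; so the quadratic form of [x] is evaluated at the vectors [Q v]. *)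
Lemma Upos_Udeg m l (x : 'M[U]_m) : Upos x -> Upos (map_mx (Udeg l) x).
Proof.
move=> xpos pi; have [Q [Qa QQ Qpi QP]] := deg_proj_rep pi l.
apply/psdblockP => v.
have /psdblockP/(_ (fun j => Q *m v j)) := xpos pi.
congr (0 <= _); apply: eq_bigr => i _; apply: eq_bigr => j _.
rewrite !mxE !Uext_inner UdegE (deg_projP (QP _ _)).
congr (x i j _); apply: pfun_inj => t; rewrite /= /coef.
transitivity (inner (Q *m (pi t *m (Q *m v j))) (v i)).
  by rewrite [RHS]inner_adj Qa.
by rewrite !mulmxA Qpi -(mulmxA _ Q Q) QQ.
Qed.

End DegreeProjection.

(** * Positivity of multiplication by f_rho *)

Section PrhoPositivity.
Variables (R : realType) (n : nat) (rho : {scalar 'M[R[i]]_n}).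
Local Notation C := R[i].
Local Notation G := 'U[R]_n.
Local Notation A := (polyfun R n).
Local Notation U := (Udual R n).
Implicit Types (pi : unitary_rep R n) (f g h : A) (x y : U).

Lemma rho_sum (X : 'M[C]_n) : rho X = \sum_a \sum_b X a b * rho (delta_mx a b).
Proof.
rewrite {1}[X]matrix_sum_delta linear_sum; apply: eq_bigr => a _.
by rewrite linear_sum; apply: eq_bigr => b _; rewrite linearZ.
Qed.

(** By linearity of the pairing and of [rho]. This turns a slice by [rho] into a pairing
    with a single function. *)
Lemma rho_dual x (F : 'I_n -> 'I_n -> A) f :
  (forall t, f t = rho (\matrix_(a, b) F a b t)) ->
  rho (\matrix_(a, b) x (F a b)) = x f.
Proof.
move=> fE; have -> : f = \sum_a \sum_b rho (delta_mx a b) *: F a b.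
  apply: pfun_inj => t; rewrite fE rho_sum pfun_sum; apply: eq_bigr => a _.
  rewrite pfun_sum; apply: eq_bigr => b _.
  by rewrite mxE -[RHS]/(rho (delta_mx a b) * F a b t) mulrC.
rewrite rho_sum linear_sum; apply: eq_bigr => a _; rewrite linear_sum.
by apply: eq_bigr => b _; rewrite linearZ mxE mulrC.
Qed.

(** Both sides pair [x] with the function [t |-> rho t . t^(l)] in terms of the tensor
    power [t^(l)] of [t], because [rho] applied to the last leg of the tensor power
    [t^(l+1)] gives [rho t . t^(l)]. *)
Lemma Uext_Prho_tpow l x :
  Uext (tpow_rep R n l) (Prho rho x) = slice rho (Uext (tpow_rep R n l.+1) x).
Proof.
apply/matrixP => p q; rewrite [LHS]mxE [RHS]mxE UmulrE.
rewrite -(@rho_dual x (fun a b => pcoef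
  (delta_mx (mrank (mrcons (mindex q) b)) 0 : 'cV[C]_(rdim (tpow_rep R n l.+1)))
  (delta_mx (mrank (mrcons (mindex p) a)) 0))).
  by congr (rho _); apply/matrixP => a b; rewrite [LHS]mxE [RHS]mxE [RHS]mxE.
move=> t; pose s := slice rho (tpow_rep R n l.+1 t).
transitivity (s p q); last first.
  rewrite mxE; congr (rho _); apply/matrixP => a b; rewrite [LHS]mxE [RHS]mxE.
  by rewrite -[RHS]/(coef _ _ t) coef_delta.
have -> : s = rho (umx t) *: tpow_rep R n l t.
  exact: (slice_etens rho (fun _ : 'I_l.+1 => umx t)).
by rewrite mxE mulrC /= coef_delta.
Qed.

Hypothesis rho_pos : positive_functional rho.

Lemma coef_tens pi pi' (xi eta : 'cV[C]_(rdim pi)) (u w : 'cV[C]_(rdim pi')) t :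
  @coef R n (tensor_rep pi pi') (xi *t u) (eta *t w) t = coef xi eta t * coef u w t.
Proof.
rewrite /coef [LHS]/inner.
have -> : (eta *t w : 'cV[C]_(rdim pi * rdim pi'))^t* = (eta^t*) *t (w^t*).
  by apply/matrixP => a b; rewrite !mxE rmorphM.
have -> : (tensor_rep pi pi' t) *m (xi *t u) = (pi t *m xi) *t (pi' t *m u).
  exact: tensmx_mul.
have -> : ((eta^t*) *t (w^t*)) *m ((pi t *m xi) *t (pi' t *m u)) =
    ((eta^t* *m (pi t *m xi)) *t (w^t* *m (pi' t *m u))).
  exact: tensmx_mul.
by rewrite mxE !ord1.
Qed.

(** Multiplication by [f_rho] is dual to tensoring with the fundamental representation
    and applying [rho] to the new leg. For fixed vectors [v_i], the quadratic form of
    [P_rho x] is then [rho] of a matrix whose own quadratic form at [u] is that of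
    [x] at the vectors [v_i (x) u]; this matrix is positive, and so is [rho]. *)
Lemma Upos_Prho m (x : 'M[U]_m) : Upos x -> Upos (map_mx (Prho rho) x).
Proof.
move=> xpos pi; apply/psdblockP => v.
pose pi' := tensor_rep pi (fund_rep R n).
pose D (u : 'cV[C]_n) i : 'cV[C]_(rdim pi') := v i *t u.
pose F i j (a b : 'I_n) : A := pcoef (D (delta_mx b 0) j) (D (delta_mx a 0) i).
have XE i j : inner (Uext pi (Prho rho (x i j)) *m v j) (v i) =
    rho (\matrix_(a, b) x i j (F i j a b)).
  rewrite Uext_inner UmulrE; apply/esym/rho_dual => t.
  rewrite -[LHS]/(coef (v j) (v i) t * rho (umx t)) -linearZ; congr (rho _).
  apply/matrixP => a b; rewrite [LHS]mxE [RHS]mxE /=.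
  have := @coef_tens pi (fund_rep R n) (v j) (v i) (delta_mx b 0) (delta_mx a 0) t.
  by rewrite coef_delta => ->.
have FE i j u : pcoef (D u j) (D u i) =
    \sum_a \sum_b ((u a 0)^* * u b 0) *: F i j a b.
  apply: pfun_inj => t; rewrite pfun_sum -[LHS]/(coef _ _ t).
  have -> := @coef_tens pi (fund_rep R n) (v j) (v i) u u t.
  rewrite [X in _ * X]/coef inner_mul mulr_sumr; apply: eq_bigr => a _.
  rewrite pfun_sum mulr_sumr; apply: eq_bigr => b _.
  rewrite -[RHS]/((u a 0)^* * u b 0 * coef (D (delta_mx b 0) j) (D (delta_mx a 0) i) t).
  have -> := @coef_tens pi (fund_rep R n) (v j) (v i) (delta_mx b 0) (delta_mx a 0) t.
  by rewrite coef_delta mulrCA.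
rewrite (_ : \sum_i _ = rho (\matrix_(a, b) \sum_i \sum_j x i j (F i j a b))); last first.
  transitivity (rho (\sum_i \sum_j \matrix_(a, b) x i j (F i j a b))).
    rewrite linear_sum; apply: eq_bigr => i _; rewrite linear_sum.
    by apply: eq_bigr => j _; rewrite !mxE XE.
  congr (rho _); apply/matrixP => a b; rewrite summxE [RHS]mxE; apply: eq_bigr => i _.
  by rewrite summxE; apply: eq_bigr => j _; rewrite mxE.
apply: rho_pos => u.
have /psdblockP/(_ (D u)) := xpos pi'.
congr (0 <= _).
transitivity (\sum_i \sum_j \sum_a \sum_b ((u a 0)^* * u b 0) * x i j (F i j a b)).
  apply: eq_bigr => i _; apply: eq_bigr => j _; rewrite mxE Uext_inner FE linear_sum.
  by apply: eq_bigr => a _; rewrite linear_sum; apply: eq_bigr => b _; rewrite linearZ.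
rewrite inner_mul.
under eq_bigr do rewrite exchange_big /=.
rewrite exchange_big /=; apply: eq_bigr => a _.
under eq_bigr do rewrite exchange_big /=.
rewrite exchange_big /=; apply: eq_bigr => b _.
rewrite mxE mulr_sumr; apply: eq_bigr => i _.
by rewrite mulr_sumr.
Qed.

End PrhoPositivity.

(** * Potentials *)

Section Potential.
Variables (R : realType) (n : nat) (rho : {scalar 'M[R[i]]_n}).
Local Notation C := R[i].
Local Notation G := 'U[R]_n.
Local Notation A := (polyfun R n).
Local Notation U := (Udual R n).
Local Notation z := (gauss R).
Local Notation T := (@translate R n).
Implicit Types (pi : unitary_rep R n) (f g h : A) (x y om : U).

Local Notation frhoM k f := (iter k (pmulr (frho rho)) f).

(** The condition under which the series of all [P_rho^k om] defines an element of the
    algebraic dual. *)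
Definition locally_finite om : Prop :=
  forall f, exists K, forall k, (K <= k)%N -> om (frhoM k f) = 0.

Lemma frhoM_linear k a f g : frhoM k (a *: f + g) = a *: frhoM k f + frhoM k g.
Proof. by elim: k => //= k ->; rewrite linearP. Qed.

Lemma iter_Prho k om f : iter k (Prho rho) om f = om (frhoM k f).
Proof.
elim: k f => [//|k IH] f.
by rewrite -[LHS]/(iter k (Prho rho) om (pmulr (frho rho) f)) IH -iterSr.
Qed.

Lemma locally_finite0 : locally_finite 0.
Proof. by move=> f; exists 0%N. Qed.

Lemma locally_finiteD om om' :
  locally_finite om -> locally_finite om' -> locally_finite (om + om').
Proof.
move=> lf lf' f; have [K KP] := lf f; have [K' KP'] := lf' f.
exists (maxn K K') => k; rewrite geq_max => /andP[kK kK'].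
by rewrite -[LHS]/(om _ + om' _) KP// KP'// addr0.
Qed.

(** On an eigenfunction [f] of the translation with eigenvalue [a], the product of [f]
    and [f_rho^k] has eigenvalue [a z ^+ k]. This equals [z ^+ l] for at most one [k],
    because [z] is not a root of unity, and for all other [k] the projection on
    degree [l] kills the product. *)
Lemma locally_finite_Udeg l x : locally_finite (Udeg l x).
Proof.
pose P f := exists K, forall k, (K <= k)%N -> Udeg l x (frhoM k f) = 0.
have Plin : linear_pred P.
  split=> [|a f g [K KP] [L LP]].
    exists 0%N => k _; suff -> : frhoM k 0 = 0 by rewrite linear0.
    by elim: k => //= k ->; rewrite linear0.
  exists (maxn K L) => k; rewrite geq_max => /andP[kK kL].
  by rewrite frhoM_linear linearP KP// LP// mulr0 addr0.
apply: (polyfun_ind Plin) => pi xi eta.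
have piN : pi (central R n) \is normalmx.
  apply/normalmxP; have aa := unitarymxP (rmxU pi (central R n)).
  by rewrite aa (mulmx1C aa).
have [E [a [E1 aE]]] := normal_eigen piN.
have -> : pcoef xi eta = \sum_i pcoef (E i *m xi) eta.
  rewrite -{1}[xi]mul1mx E1 mulmx_suml.
  apply: (big_morph (fun u => pcoef u eta)) => [u v|]; first exact: pcoefDl.
  by rewrite -(scale0r 0) pcoefZl scale0r.
apply: (linear_pred_sum Plin) => i _.
have Tk k : T (frhoM k (pcoef (E i *m xi) eta)) =
    (a i * z ^+ k) *: frhoM k (pcoef (E i *m xi) eta).
  elim: k => [|k IH].
    by rewrite expr0 mulr1 translate_pcoef mulmxA aE -scalemxAl pcoefZl.
  rewrite iterS translateM IH translate_frho; apply: pfun_inj => t.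
  rewrite -[LHS]/(a i * z ^+ k * (frhoM k _) t * (z * frho rho t)).
  rewrite -[RHS]/(a i * z ^+ k.+1 * ((frhoM k _) t * frho rho t)).
  by rewrite mulrACA exprSr (mulrA (a i)).
have [[k0 k0P]|no] := pselect (exists k, a i * z ^+ k = z ^+ l).
  exists k0.+1 => k kk0; rewrite UdegE (deg_proj_eq0 (Tk k)) ?linear0//.
  rewrite -k0P; apply: contraTneq kk0 => /mulfI H; rewrite -leqNgt.
  have a0 : a i != 0.
    apply: contraTneq (gauss_neq0 R) => a0.
    by have /eqP := k0P; rewrite a0 mul0r eq_sym expf_eq0 => /andP[_ ->].
  by have /gauss_inj -> := H a0.
exists 0%N => k _; rewrite UdegE (deg_proj_eq0 (Tk k)) ?linear0//.
by apply/eqP => E'; apply: no; exists k.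
Qed.

Lemma sum_stable (F : nat -> C) K L : (forall k, (K <= k)%N -> F k = 0) ->
  (K <= L)%N -> \sum_(k < L) F k = \sum_(k < K) F k.
Proof.
move=> F0 KL; rewrite -!(big_mkord xpredT F) (big_cat_nat (leq0n K) KL)//=.
by rewrite [X in _ + X]big_nat [X in _ + X]big1 ?addr0// => k /andP[/F0].
Qed.

Lemma potential_ex om : locally_finite om -> exists y : U,
  forall f K, (forall k, (K <= k)%N -> om (frhoM k f) = 0) ->
    y f = \sum_(k < K) om (frhoM k f).
Proof.
move=> lf; pose K f := sval (cid (lf f)).
have KP f k : (K f <= k)%N -> om (frhoM k f) = 0 by rewrite /K; case: cid => ? /=; exact.
pose v f := \sum_(k < K f) om (frhoM k f).
have vE f L : (forall k, (L <= k)%N -> om (frhoM k f) = 0) ->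
    v f = \sum_(k < L) om (frhoM k f).
  move=> LP; rewrite /v; case: (leqP L (K f)) => [H|/ltnW H].
    exact: (sum_stable LP H).
  exact/esym/(sum_stable (KP f) H).
have vL : scalar v.
  move=> a f g; pose M := maxn (K f) (K g).
  have fM k : (M <= k)%N -> om (frhoM k f) = 0.
    by rewrite geq_max => /andP[/KP].
  have gM k : (M <= k)%N -> om (frhoM k g) = 0.
    by rewrite geq_max => /andP[_ /KP].
  rewrite (vE f M fM) (vE g M gM) (vE _ M) => [|k kM]; last first.
    by rewrite frhoM_linear linearP fM// gM// mulr0 addr0.
  rewrite mulr_sumr -big_split; apply: eq_bigr => k _.
  by rewrite frhoM_linear linearP.
by exists (dual_of vL).
Qed.

Lemma slice_linear l a (X Y : 'M[C]_(tdim n l.+1)) :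
  slice rho (a *: X + Y) = a *: slice rho X + slice rho Y.
Proof.
apply/matrixP => p q; rewrite !mxE -[RHS](linearP rho); congr (rho _).
by apply/matrixP => c d; rewrite !mxE.
Qed.

Lemma slice0 l : slice rho (0 : 'M[C]_(tdim n l.+1)) = 0.
Proof.
have := slice_linear (-1) 0 (0 : 'M[C]_(tdim n l.+1)).
by rewrite scaler0 addr0 scaleN1r addNr.
Qed.

Lemma gspan_slice l (X : 'M[C]_(tdim n l.+1)) :
  @gspan R n (tpow_rep R n l.+1) X -> @gspan R n (tpow_rep R n l) (slice rho X).
Proof.
move=> [c ->]; have Plin := gspan_linear_pred (tpow_rep R n l).
rewrite /galg; elim: c => [|p c IH]; first by rewrite big_nil slice0; case: Plin.
rewrite big_cons slice_linear; case: (Plin) => _; apply=> //.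
rewrite (slice_etens rho (fun _ : 'I_l.+1 => umx p.2)).
apply: (linear_predZ _ Plin); exact: gspan_rep (tpow_rep R n l) p.2.
Qed.

Variable m : nat.

Hypothesis rho_pos : positive_functional rho.

Lemma Upos_iter_Prho k (om : 'M[U]_m) :
  Upos om -> Upos (map_mx (iter k (Prho rho)) om).
Proof.
move=> omp; elim: k => [|k IH].
  by rewrite (_ : map_mx _ _ = om)//; apply/matrixP => i j; rewrite mxE.
rewrite (_ : map_mx _ _ = map_mx (Prho rho) (map_mx (iter k (Prho rho)) om)).
  exact: Upos_Prho.
by apply/matrixP => i j; rewrite !mxE.
Qed.

(** In a given representation only finitely many terms of the potential are nonzero,
    uniformly over the finitely many matrix entries. *)
Lemma Upos_potential (om y : 'M[U]_m) : Upos om ->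
    (forall i j, locally_finite (om i j)) ->
    (forall i j f K, (forall k, (K <= k)%N -> om i j (frhoM k f) = 0) ->
       y i j f = \sum_(k < K) om i j (frhoM k f)) ->
  Upos y.
Proof.
move=> omp lf yE pi.
(* A tuple [s] is a block position followed by a position in the block. *)
have /choice[K KP] : forall s : 'I_m * 'I_m * 'I_(rdim pi) * 'I_(rdim pi),
    exists K, forall k, (K <= k)%N ->
      om s.1.1.1 s.1.1.2 (frhoM k (pcoef (delta_mx s.2 0) (delta_mx s.1.2 0))) = 0.
  by move=> s; exact: lf.
pose M := \max_s K s.
rewrite (_ : map_mx _ _ = \sum_(k < M) map_mx (Uext pi) (map_mx (iter k (Prho rho)) om)).
  by apply: psdblock_sum => k; exact: Upos_iter_Prho.
apply/matrixP => i j; apply/matrixP => p q.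
rewrite summxE summxE [(map_mx _ y) i j]mxE [LHS]mxE (yE _ _ _ M).
  by apply: eq_bigr => k _; rewrite !mxE iter_Prho.
move=> k Mk; apply: (KP (i, j, p, q)); apply: leq_trans Mk.
exact: (leq_bigmax (i, j, p, q)).
Qed.

End Potential.

(** * The image of the superharmonic elements *)

Section Image.
Variables (R : realType) (m n : nat) (rho : {scalar 'M[R[i]]_n}).
Local Notation C := R[i].
Local Notation G := 'U[R]_n.
Local Notation A := (polyfun R n).
Local Notation U := (Udual R n).
Implicit Types (x y om : 'M[U]_m).

Lemma taction_Uext l (sigma : 'S_l) (x : U) :
  taction sigma (Uext (tpow_rep R n l) x) = Uext (tpow_rep R n l) x.
Proof.
apply/matrixP => p q; rewrite [LHS]mxE [LHS]mxE [RHS]mxE.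
congr (x _); apply: pfun_inj => t; rewrite -[LHS]/(coef _ _ t) -[RHS]/(coef _ _ t).
rewrite !coef_delta.
have /matrixP/(_ p q) := taction_etens sigma (fun=> umx t).
by rewrite mxE.
Qed.

Lemma map_UextB (pi : unitary_rep R n) x y :
  map_mx (Uext pi) (x - y) = map_mx (Uext pi) x - map_mx (Uext pi) y.
Proof. by apply/matrixP => i j; rewrite !mxE UextB. Qed.

Lemma map_UextD (pi : unitary_rep R n) x y :
  map_mx (Uext pi) (x + y) = map_mx (Uext pi) x + map_mx (Uext pi) y.
Proof. by apply/matrixP => i j; rewrite !mxE UextD. Qed.

Lemma Pi_infB x y l : Pi_inf (x - y) l = Pi_inf x l - Pi_inf y l.
Proof. exact: (map_UextB (tpow_rep R n l)). Qed.

Lemma Pi_infD x y l : Pi_inf (x + y) l = Pi_inf x l + Pi_inf y l.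
Proof. exact: (map_UextD (tpow_rep R n l)). Qed.

Lemma Pi_inf_Prho x l :
  Pi_inf (map_mx (Prho rho) x) l = map_mx (slice rho) (Pi_inf x l.+1).
Proof. by apply/matrixP => i j; rewrite !mxE Uext_Prho_tpow. Qed.

Lemma Pi_inf_Kset x : Bset m rho x -> Kset m rho (Pi_inf x).
Proof.
move=> [xpos xsup] l; split=> [i j sigma||].
- by rewrite mxE taction_Uext.
- exact: (xpos (tpow_rep R n l)).
- by rewrite -Pi_inf_Prho -Pi_infB; exact: (xsup (tpow_rep R n l)).
Qed.

Hypothesis rho_pos : positive_functional rho.

Lemma gspan_Kset (w : tseq R n m) l i j : Kset m rho w ->
  @gspan R n (tpow_rep R n l) (w l i j).
Proof. by move=> wK; apply: schur_weyl; have [] := wK l. Qed.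

(** The element [y] is the sum of all [P_rho^k om], which solves [y - P_rho y = om]. As
    [P_rho] only looks at higher tensor powers, [y] vanishes on the tensor powers
    above those where [om] lives. *)
Lemma potential (om : 'M[U]_m) :
    Upos om -> (forall i j, locally_finite rho (om i j)) ->
  exists2 y, Upos y & y = om + map_mx (Prho rho) y /\
    forall N, (forall l, (N < l)%N -> Pi_inf om l = 0) ->
      forall l, (N < l)%N -> Pi_inf y l = 0.
Proof.
move=> omp lf.
have /choice[y0 y0P] : forall ij : 'I_m * 'I_m, exists y : U,
  forall f K, (forall k, (K <= k)%N -> om ij.1 ij.2 (iter k (pmulr (frho rho)) f) = 0) ->
    y f = \sum_(k < K) om ij.1 ij.2 (iter k (pmulr (frho rho)) f).
  by move=> [i j]; exact: potential_ex.
pose y : 'M[U]_m := \matrix_(i, j) y0 (i, j).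
have yE i j f K : (forall k, (K <= k)%N -> om i j (iter k (pmulr (frho rho)) f) = 0) ->
    y i j f = \sum_(k < K) om i j (iter k (pmulr (frho rho)) f).
  by move=> KP; rewrite mxE; exact: (y0P (i, j)).
exists y; first exact: (Upos_potential rho_pos omp lf).
split=> [|N omN l lN].
  apply/matrixP => i j; rewrite [RHS]mxE [X in _ = _ + X]mxE.
  apply: scalar_ext => f.
  rewrite -[RHS]/(om i j f + y i j (pmulr (frho rho) f)).
  have [K KP] := lf i j f.
  rewrite (yE i j f K.+1) => [|k kK]; last by apply: KP; exact: ltnW.
  rewrite (yE _ _ (pmulr _ f) K) => [|k kK]; last by rewrite -iterSr KP// leqW.
  rewrite big_ord_recl /=; congr (_ + _); apply: eq_bigr => k _.
  by rewrite -iterSr.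
have iter0 k i j l' : (N < l')%N -> Uext (tpow_rep R n l') (iter k (Prho rho) (om i j)) = 0.
  elim: k l' => [|k IH] l' l'N.
    by have /matrixP/(_ i j) := omN _ l'N; rewrite !mxE.
  rewrite iterS Uext_Prho_tpow IH ?slice0//; exact: ltnW.
apply/matrixP => i j; rewrite [LHS]mxE [RHS]mxE.
apply/matrixP => p q; rewrite [LHS]mxE [RHS]mxE.
set f := pcoef _ _; have [K KP] := lf i j f.
rewrite (yE _ _ _ K)// big1// => k _; rewrite -iter_Prho.
by have /matrixP/(_ p q) := iter0 k i j l lN; rewrite !mxE.
Qed.

Lemma Pi_inf_sum I (r : seq I) (F : I -> 'M[U]_m) l :
  Pi_inf (\sum_(k <- r) F k) l = \sum_(k <- r) Pi_inf (F k) l.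
Proof.
apply: (big_morph (fun x => Pi_inf x l)) => [x y|]; first exact: Pi_infD.
by apply/matrixP => i j; rewrite !mxE Uext0.
Qed.

Lemma Upos_sum I (r : seq I) (F : I -> 'M[U]_m) :
  (forall k, Upos (F k)) -> Upos (\sum_(k <- r) F k).
Proof.
move=> Fp pi; rewrite (_ : map_mx _ _ = \sum_(k <- r) map_mx (Uext pi) (F k)).
  by apply: psdblock_sum => k; exact: Fp.
apply: (big_morph (fun x => map_mx (Uext pi) x)) => [x y|]; first exact: map_UextD.
by apply/matrixP => i j; rewrite !mxE Uext0.
Qed.

(** By the factorization, [w] is the image of a matrix [c^adj c] over the group algebra,
    and such a matrix is positive in every representation. *)
Lemma lift_psdblock l (w : 'M['M[C]_(tdim n l)]_m) : psdblock w ->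
    (forall i j, @gspan R n (tpow_rep R n l) (w i j)) ->
  exists om : 'M[U]_m, Upos om /\ Pi_inf om l = w.
Proof.
move=> wp wspan; have [c cE] := @psdblock_gspan R n m (tpow_rep R n l) w wp wspan.
pose om : 'M[U]_m := \matrix_(i, j) point_dual (fun k => c k i) (fun k => c k j).
have omE pi i j : Uext pi (om i j) = \sum_k (galg pi (c k i))^t* *m galg pi (c k j).
  by rewrite mxE Uext_point_dual.
exists om; split; last by apply/matrixP => i j; rewrite mxE cE omE.
move=> pi; apply/psdblockP => v.
rewrite (_ : \sum_i _ = \sum_k inner (\sum_j galg pi (c k j) *m v j)
                                     (\sum_j galg pi (c k j) *m v j)).
  by apply: sumr_ge0 => k _; exact: inner_ge0.
under [RHS]eq_bigr do rewrite inner_sumr.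
rewrite [RHS]exchange_big /=; apply: eq_bigr => i _.
under [RHS]eq_bigr do rewrite inner_suml.
rewrite [RHS]exchange_big /=; apply: eq_bigr => j _.
rewrite mxE omE mulmx_suml inner_suml; apply: eq_bigr => k _.
by rewrite -[in LHS]mulmxA [LHS]inner_adj trmxCK.
Qed.

(** The defects [d l] are positive, and they are the images of an element [om] that has
    one component in each degree up to [N]. The potential of [om] has the same defects
    as [w], and like [w] it vanishes above [N]; so the two agree, by descending
    induction on [l]. *)
Theorem finite_Kset_image (w : tseq R n m) N : Kset m rho w ->
  (forall l, (N < l)%N -> w l = 0) -> exists2 y, Bset m rho y & Pi_inf y = w.
Proof.
move=> wK w0; pose d l := w l - map_mx (slice rho) (w l.+1).
have /choice[om0 om0P] : forall l, exists om : 'M[U]_m, Upos om /\ Pi_inf om l = d l.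
  move=> l; apply: lift_psdblock; first by have [] := wK l.
  move=> i j; rewrite !mxE; have Plin := gspan_linear_pred (tpow_rep R n l).
  rewrite addrC -scaleN1r; case: (Plin) => _; apply; last exact: gspan_Kset.
  by apply: gspan_slice; exact: gspan_Kset.
(* The projections on the degrees make the lifts independent of each other. *)
pose om : 'M[U]_m := \sum_(l < N.+1) map_mx (Udeg l) (om0 l).
have omp : Upos om by apply: Upos_sum => l; apply: Upos_Udeg; have [] := om0P l.
have lf i j : locally_finite rho (om i j).
  rewrite summxE; elim/big_ind: _ => [|u v|l _]; first exact: locally_finite0.
    exact: locally_finiteD.
  by rewrite mxE; exact: locally_finite_Udeg.
have omE l : Pi_inf om l = if (l <= N)%N then d l else 0.
  have E (k : 'I_N.+1) : Pi_inf (map_mx (Udeg k) (om0 k)) l =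
      if l == k :> nat then d l else 0.
    apply/matrixP => i j; rewrite [LHS]mxE [X in Uext _ X]mxE Uext_Udeg_tpow.
    case: eqVneq => [->|_]; last by rewrite mxE.
    by have [_ <-] := om0P k; rewrite mxE.
  rewrite Pi_inf_sum; under eq_bigr do rewrite E.
  rewrite -big_mkcond /=; case: leqP => lN; last first.
    by rewrite big1// => k /eqP lk; have := ltn_ord k; rewrite -lk ltnS leqNgt lN.
  rewrite -ltnS in lN.
  by rewrite (big_pred1 (Ordinal lN))// => k; rewrite eq_sym.
have [y yp [yE yN]] := potential omp lf.
have yN' l : (N < l)%N -> Pi_inf y l = 0.
  by move: l; apply: yN => l lN; rewrite omE leqNgt lN.
exists y.
  by split; [exact: yp | rewrite {1}yE addrK; exact: omp].
(* [k] bounds the distance from [l] to the range above [N] where both sides vanish. *)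
suff H k l : (N < l + k)%N -> Pi_inf y l = w l.
  by apply: functional_extensionality_dep => l; apply: (H N.+1); rewrite addnS ltnS leq_addl.
elim: k l => [|k IH] l; first by rewrite addn0 => lN; rewrite yN'// w0.
rewrite addnS -addSn => /IH yl.
have [lN|lN] := leqP l N; last by rewrite yN'// w0.
by rewrite yE Pi_infD omE lN Pi_inf_Prho yl subrK.
Qed.

End Image.

(** * Topology of the product and the closure *)

Lemma entry_continuous (S : topologicalType) p q i j :
  continuous (fun M : 'M[S]_(p, q) => M i j).
Proof.
move=> M B nB; exists (fun i' j' => if (i' == i) && (j' == j) then B else setT).
  by move=> i' j'; case: ifP => [/andP[/eqP-> /eqP->]//|_]; exact: filterT.
by move=> N /(_ i j); rewrite !eqxx.
Qed.

Section Closedness.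
Variables (R : realType) (m n : nat) (rho : {scalar 'M[R[i]]_n}).
Local Notation C := R[i].

Lemma tseq_entry_continuous l i j p q :
  continuous (fun x : tseq R n m => x l i j p q : C).
Proof.
move=> x; have c1 : {for x, continuous (fun x : tseq R n m => x l)}.
  exact: (@proj_continuous _ (fun l => 'M['M[C]_(tdim n l)]_m) l x).
have c2 : {for x, continuous (fun x : tseq R n m => x l i j)}.
  exact: (continuous_comp c1 (@entry_continuous _ _ _ i j _)).
exact: (continuous_comp c2 (@entry_continuous _ _ _ p q _)).
Qed.

Lemma continuous_sumC (S : topologicalType) (I : Type) (r : seq I) (F : I -> S -> C) :
  (forall i, continuous (F i)) -> continuous (fun x => \sum_(i <- r) F i x).
Proof.
move=> Fc; elim: r => [|i r IHr].
  have -> : (fun x => \sum_(i <- [::]) F i x) = (fun=> 0).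
    by apply/funext => x; rewrite big_nil.
  exact: cst_continuous.
have -> : (fun x => \sum_(j <- i :: r) F j x) =
    (fun x => F i x + \sum_(j <- r) F j x).
  by apply/funext => x; rewrite big_cons.
by move=> x; apply: cvgD; [exact: Fc|exact: IHr].
Qed.

Lemma continuousBC (S : topologicalType) (f g : S -> C) :
  continuous f -> continuous g -> continuous (fun x => f x - g x).
Proof. by move=> fc gc x; apply: cvgB; [exact: fc|exact: gc]. Qed.

Lemma closed_eq0 (S : topologicalType) (f : S -> C) :
  continuous f -> closed [set x | f x = 0].
Proof.
move=> fc; rewrite (_ : [set x | f x = 0] = f @^-1` [set 0])//.
apply: closed_comp => [x _|]; first exact: fc.
exact/accessible_closed_set1/hausdorff_accessible/norm_hausdorff.
Qed.

Lemma closed_ge0 (S : topologicalType) (f : S -> C) :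
  continuous f -> closed [set x | 0 <= f x].
Proof.
move=> fc; rewrite (_ : [set x | 0 <= f x] = [set x | `|f x| - f x = 0]).
  apply: closed_eq0 => x; apply: cvgB; last exact: fc.
  by apply: (cvg_norm (fc x)).
apply/seteqP; split=> x /=; first by move=> /ger0_norm ->; rewrite subrr.
by move=> /eqP; rewrite subr_eq0 => /eqP <-.
Qed.

Lemma quadratic_continuous (S : topologicalType) d (f : S -> 'M['M[C]_d]_m)
    (v : 'I_m -> 'cV[C]_d) :
  (forall i j p q, continuous (fun x => f x i j p q : C)) ->
  continuous (fun x => \sum_i \sum_j inner (f x i j *m v j) (v i)).
Proof.
move=> fc; apply: continuous_sumC => i; apply: continuous_sumC => j.
under eq_fun do rewrite inner_mul.
apply: continuous_sumC => p; apply: continuous_sumC => q.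
by apply: continuousMC; [exact: cst_continuous|exact: fc].
Qed.

Lemma closed_psdblock (S : topologicalType) d (f : S -> 'M['M[C]_d]_m) :
  (forall i j p q, continuous (fun x => f x i j p q : C)) ->
  closed [set x | psdblock (f x)].
Proof.
move=> fc; rewrite (_ : [set x | _] = \bigcap_v
    [set x | 0 <= \sum_i \sum_j inner (f x i j *m v j) (v i)]).
  by apply: closed_bigI => v _; apply: closed_ge0; exact: quadratic_continuous.
apply/seteqP; split=> x /= => [/psdblockP xp v _|xp]; first exact: xp.
by apply/psdblockP => v; exact: xp.
Qed.

Lemma closed_Kset : closed (Kset m rho).
Proof.
have E : Kset m rho = \bigcap_l
   ((\bigcap_i \bigcap_j \bigcap_sigma \bigcap_p \bigcap_q
       [set x : tseq R n m | taction sigma (x l i j) p q - x l i j p q = 0]) `&`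
    [set x : tseq R n m | psdblock (x l)] `&`
    [set x : tseq R n m | psdblock (x l - map_mx (slice rho) (x l.+1))]).
  apply/seteqP; split=> x xK l.
    move=> _; have [xs xp xd] := xK l.
    split; [split; [move=> i _ j _ s _ p _ q _ | exact: xp] | exact: xd].
    by rewrite /= xs subrr.
  have [[xs xp] xd] := xK l I; split; [move=> i j s | exact: xp | exact: xd].
  apply/matrixP => p q.
  by apply/eqP; rewrite -subr_eq0; apply/eqP; exact: (xs i I j I s I p I q I).
rewrite E; apply: closed_bigI => l _; apply: closedI; first apply: closedI.
- apply: closed_bigI => i _; apply: closed_bigI => j _; apply: closed_bigI => s _.
  apply: closed_bigI => p _; apply: closed_bigI => q _; apply: closed_eq0.
  under eq_fun do rewrite mxE.
  by apply: continuousBC; exact: tseq_entry_continuous.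
- apply: closed_psdblock => i j p q; exact: tseq_entry_continuous.
- apply: closed_psdblock => i j p q.
  have -> : (fun x : tseq R n m => (x l - map_mx (slice rho) (x l.+1)) i j p q) =
    (fun x : tseq R n m => x l i j p q - \sum_a \sum_b
       x l.+1 i j (mrank (mrcons (mindex p) a)) (mrank (mrcons (mindex q) b)) *
       rho (delta_mx a b)).
    apply/funext => x; rewrite !mxE rho_sum; congr (_ - _).
    by apply: eq_bigr => a _; apply: eq_bigr => b _; rewrite mxE.
  apply: continuousBC; first exact: tseq_entry_continuous.
  apply: continuous_sumC => a; apply: continuous_sumC => b.
  by apply: continuousMC; [exact: tseq_entry_continuous|exact: cst_continuous].
Qed.

Definition truncate N (x : tseq R n m) : tseq R n m :=
  fun l => if (l <= N)%N then x l else 0.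

Lemma truncate_cvg (x : tseq R n m) : truncate N x @[N --> \oo] --> x.
Proof.
apply/cvg_sup => l B [_ [[V Vo <-] Vx sVB]].
exists l => // N /= lN; apply: sVB; rewrite /= /truncate lN; exact: Vx.
Qed.

Lemma Kset_truncate N x : Kset m rho x -> Kset m rho (truncate N x).
Proof.
move=> xK l; have [xs xp xd] := xK l; rewrite /truncate.
have sl0 : map_mx (slice rho) (0 : 'M['M[C]_(tdim n l.+1)]_m) = 0.
  by apply/matrixP => i j; rewrite !mxE slice0.
case: (leqP l N) => lN; last first.
  rewrite leqNgt (leqW lN) /= sl0 subr0; split=> [i j s||]; try exact: psdblock0.
  by apply/matrixP => p q; rewrite !mxE.
split; [exact: xs | exact: xp |].
case: (ltnP l N) => _; first exact: xd.
by rewrite sl0 subr0.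
Qed.

End Closedness.

Theorem proposition6p2 (R : realType) (m n : nat) (hm : (0 < m)%N) (hn : (0 < n)%N)
    (rho : {scalar 'M[R[i]]_n})
    (rho_pos : positive_functional rho) (rho_faithful : faithful_functional rho) :
  Kset m rho = closure (Pi_inf @` Bset m rho).
Proof.
apply/seteqP; split=> [x xK V xV|].
  have [N _ NV] := truncate_cvg xV.
  have zero l : (N < l)%N -> truncate N x l = 0.
    by rewrite /truncate ltnNge => /negbTE ->.
  have [y yB yE] := finite_Kset_image rho_pos (Kset_truncate N xK) zero.
  exists (truncate N x); split; first by exists y.
  by apply: NV => /=.
have /closure_id -> := @closed_Kset R m n rho.
by apply: closureS => _ [y yB <-]; exact: Pi_inf_Kset.
Qed.
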